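(* Suppose $M$ is a transitive model of $\mathrm{ZFC}$, $j\colon M\to M$ is an elementary embedding with critical point $\kappa$, $\mathcal U=\{X\in \mathcal{P}(\kappa)\cap M: \kappa\in j(X)\}$ is the normal ultrafilter on $\kappa$ derived from $j$, and $\mathcal U\in M$. Then: (1) $M\models o(\kappa)=(2^\kappa)^+$; (2) $M\models$ ''for every $X\subseteq\mathcal{P}(\kappa)$ there is a normal measure $\mu$ on $\kappa$ such that $X\in\mathrm{Ult}(V,\mu)$''; (3) for $\mathcal U$-measure one many $\alpha<\kappa$, $M$ satisfies statements (1) and (2) with $\alpha$ in place of $\kappa$; and in fact (4) for every formula $\varphi$ and every $A\in\mathcal{P}(\kappa)\cap M$, $M\models\varphi(A)$ if and only if $M\models\varphi(A\cap\alpha)$ for $\mathcal U$-measure one many $\alpha<\kappa$.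
   Context: $o(\kappa)$ denotes the Mitchell order of $\kappa$. $\mathrm{Ult}(V,\mu)$ is the ultrapower of the universe by $\mu$ (interpreted inside $M$ in (2)). *)

(* Defs.v *)
Set Implicit Arguments.
Unset Strict Implicit.
Unset Printing Implicit Defensive.

Record structure : Type := Structure {
  dom :> Type;
  mem : dom -> dom -> Prop
}.

Declare Scope set_scope.
Open Scope set_scope.
Notation "x ∈ y" := (mem x y) (at level 70, no associativity) : set_scope.

(* A class of V, with the membership relation of V. *)
Definition restrict (V : structure) (M : V -> Prop) : structure :=
  {| dom := {x : V | M x}; mem := fun x y => proj1_sig x ∈ proj1_sig y |}.

Definition transitive_class (V : structure) (M : V -> Prop) : Prop :=
  forall x y : V, M y -> x ∈ y -> M x.

Inductive formula : Type :=
| fMem (x y : nat)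
| fEq (x y : nat)
| fNot (phi : formula)
| fAnd (phi psi : formula)
| fAll (x : nat) (phi : formula).

Definition upd (D : Type) (s : nat -> D) (x : nat) (d : D) : nat -> D :=
  fun y => if Nat.eqb y x then d else s y.

Fixpoint sat (D : structure) (phi : formula) (s : nat -> D) : Prop :=
  match phi with
  | fMem x y => s x ∈ s y
  | fEq x y => s x = s y
  | fNot phi => ~ sat phi s
  | fAnd phi psi => sat phi s /\ sat psi s
  | fAll x phi => forall d : D, sat phi (upd s x d)
  end.

Definition elementary (D D' : structure) (j : D -> D') : Prop :=
  forall (phi : formula) (s : nat -> D),
    sat phi s <-> sat phi (fun n => j (s n)).

(* First-order set theory inside a structure D. Every quantifier ranges over
   elements of D, so a notion below, taken in D, is its interpretation in the
   model D (the predicate arguments Q are only ever instantiated by notions of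
   the same kind). Defined set-theoretic terms are rendered by their graphs. *)
Section SetTheory.
Variable D : structure.
Implicit Types (a b c d f g o p r x y z : D).

Definition subset x y := forall z, z ∈ x -> z ∈ y.
Definition is_powerset p x := forall y, y ∈ p <-> subset y x.
Definition is_inter z x y := forall w, w ∈ z <-> w ∈ x /\ w ∈ y.

Definition is_upair z x y := forall w, w ∈ z <-> w = x \/ w = y.
Definition is_opair p x y :=
  exists a b, is_upair a x x /\ is_upair b x y /\ is_upair p a b.

(* f(x) = y, when f is a function *)
Definition app f x y := exists p, p ∈ f /\ is_opair p x y.
Definition is_fun f d :=
  (forall p, p ∈ f -> exists x y, x ∈ d /\ is_opair p x y) /\
  (forall x, x ∈ d -> exists! y, app f x y).
Definition is_fun_into f d c :=
  is_fun f d /\ forall x y, app f x y -> y ∈ c.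
Definition is_bijection f d c :=
  is_fun_into f d c /\ forall y, y ∈ c -> exists! x, app f x y.
Definition equinumerous a b := exists f, is_bijection f a b.

(* Well-foundedness of the membership relation is the axiom of foundation. *)
Definition is_ordinal o :=
  (forall x, x ∈ o -> subset x o) /\
  (forall x y, x ∈ o -> y ∈ o -> x ∈ y \/ x = y \/ y ∈ x).
Definition is_cardinal o :=
  is_ordinal o /\ forall a, a ∈ o -> ~ equinumerous a o.
Definition is_cardinality_of o x := is_cardinal o /\ equinumerous x o.
Definition is_succ_cardinal o lambda :=
  is_cardinal o /\ lambda ∈ o /\
  forall o', is_cardinal o' -> lambda ∈ o' -> subset o o'.

(* o is the least ordinal above every ordinal beta with Q beta, that is,
   the supremum of all beta + 1. *)
Definition is_strict_sup (Q : D -> Prop) o :=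
  is_ordinal o /\ (forall beta, Q beta -> beta ∈ o) /\
  forall o', is_ordinal o' -> (forall beta, Q beta -> beta ∈ o') -> subset o o'.

Record ZFC : Prop := {
  extensionality : forall x y, (forall z, z ∈ x <-> z ∈ y) -> x = y;
  foundation : forall x, (exists y, y ∈ x) ->
    exists y, y ∈ x /\ forall z, z ∈ x -> ~ z ∈ y;
  pairing : forall x y, exists z, is_upair z x y;
  union : forall x, exists u, forall z, z ∈ u <-> exists y, y ∈ x /\ z ∈ y;
  powerset : forall x, exists p, is_powerset p x;
  infinity : exists a,
    (exists e, e ∈ a /\ forall z, ~ z ∈ e) /\
    (forall x, x ∈ a ->
       exists y, y ∈ a /\ forall z, z ∈ y <-> z ∈ x \/ z = x);
  separation : forall (phi : formula) (s : nat -> D) x,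
    exists y, forall z, z ∈ y <-> z ∈ x /\ sat phi (upd s 0 z);
  replacement : forall (phi : formula) (s : nat -> D) x,
    (forall z, z ∈ x -> exists! w, sat phi (upd (upd s 0 z) 1 w)) ->
    exists y, forall w,
      w ∈ y <-> exists z, z ∈ x /\ sat phi (upd (upd s 0 z) 1 w);
  choice : forall x, (forall y, y ∈ x -> exists z, z ∈ y) ->
    exists f, is_fun f x /\ forall y z, y ∈ x -> app f y z -> z ∈ y
}.

(* {alpha < kappa : Q alpha} belongs to mu. *)
Definition measure_one (kappa mu : D) (Q : D -> Prop) : Prop :=
  exists S, S ∈ mu /\ forall alpha, alpha ∈ S <-> alpha ∈ kappa /\ Q alpha.

Definition is_ultrafilter (kappa mu : D) : Prop :=
  (forall x, x ∈ mu -> subset x kappa) /\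
  kappa ∈ mu /\
  (forall x y, x ∈ mu -> subset x y -> subset y kappa -> y ∈ mu) /\
  (forall x y z, x ∈ mu -> y ∈ mu -> is_inter z x y -> z ∈ mu) /\
  (forall x y, subset x kappa ->
     (forall z, z ∈ y <-> z ∈ kappa /\ ~ z ∈ x) -> (x ∈ mu <-> ~ y ∈ mu)).

Definition is_nonprincipal (kappa mu : D) : Prop :=
  forall alpha x, alpha ∈ kappa -> is_upair x alpha alpha -> ~ x ∈ mu.

(* closure under intersections of sequences of length gamma < kappa *)
Definition is_complete (kappa mu : D) : Prop :=
  forall gamma f, gamma ∈ kappa -> is_fun_into f gamma mu ->
    measure_one kappa mu
      (fun alpha => forall xi x, xi ∈ gamma -> app f xi x -> alpha ∈ x).

(* closure under diagonal intersections *)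
Definition is_normal (kappa mu : D) : Prop :=
  forall f, is_fun_into f kappa mu ->
    measure_one kappa mu
      (fun alpha => forall xi x, xi ∈ alpha -> app f xi x -> alpha ∈ x).

Definition normal_measure (kappa mu : D) : Prop :=
  is_ordinal kappa /\ is_ultrafilter kappa mu /\ is_nonprincipal kappa mu /\
  is_complete kappa mu /\ is_normal kappa mu.

Definition ult_eq (kappa mu f g : D) : Prop :=
  measure_one kappa mu (fun alpha => exists y, app f alpha y /\ app g alpha y).
Definition ult_mem (kappa mu f g : D) : Prop :=
  measure_one kappa mu
    (fun alpha => exists y z, app f alpha y /\ app g alpha z /\ y ∈ z).

(* Ult(V,mu) is identified with its transitive collapse: the class of all
   pi(f), for f a function on kappa, where pi(f) = {pi(g) : g ult_mem f}.
   As pi is a proper class it is given, as in the recursion theorem, by its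
   set-sized approximations c; the domain d of an approximation contains,
   up to ult_eq, all ult_mem-predecessors of its elements. *)
Definition ult_collapse (kappa mu c d : D) : Prop :=
  is_fun c d /\
  (forall f, f ∈ d -> is_fun f kappa) /\
  (forall f g, f ∈ d -> is_fun g kappa -> ult_mem kappa mu g f ->
     exists g', g' ∈ d /\ ult_eq kappa mu g' g) /\
  (forall f y, f ∈ d -> app c f y ->
     forall z, z ∈ y <-> exists g, g ∈ d /\ ult_mem kappa mu g f /\ app c g z).

Definition in_Ult (kappa mu x : D) : Prop :=
  exists c d f, ult_collapse kappa mu c d /\ f ∈ d /\ app c f x.

Definition mitchell_lt (kappa mu nu : D) : Prop :=
  normal_measure kappa mu /\ normal_measure kappa nu /\ in_Ult kappa nu mu.

Definition is_mitchell_rank (kappa r : D) : Prop :=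
  exists d, (forall mu, mu ∈ d <-> normal_measure kappa mu) /\
    is_fun r d /\
    forall nu o, nu ∈ d -> app r nu o ->
      is_strict_sup (fun beta => exists mu, mitchell_lt kappa mu nu /\
                                            app r mu beta) o.

(* o = o(kappa) *)
Definition is_mitchell_order (kappa o : D) : Prop :=
  exists r, is_mitchell_rank kappa r /\
    is_strict_sup (fun beta => exists mu, app r mu beta) o.

(* o(kappa) = (2^kappa)^+ *)
Definition mitchell_order_eq_succ_pow (kappa : D) : Prop :=
  exists o p lambda, is_mitchell_order kappa o /\
    is_powerset p kappa /\ is_cardinality_of lambda p /\
    is_succ_cardinal o lambda.

Definition every_subset_of_powerset_in_Ult (kappa : D) : Prop :=
  forall X, (forall x, x ∈ X -> subset x kappa) ->
    exists mu, normal_measure kappa mu /\ in_Ult kappa mu X.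

Definition critical_point (j : D -> D) (kappa : D) : Prop :=
  is_ordinal kappa /\ j kappa <> kappa /\
  forall beta, beta ∈ kappa -> j beta = beta.

Definition derived_ultrafilter (j : D -> D) (kappa U : D) : Prop :=
  forall X, X ∈ U <-> subset X kappa /\ kappa ∈ j X.

End SetTheory.

(* Main.v *)
(* Since kappa ∩ j A = A for A ⊆ kappa, elementarity gives, for every definable
   Q, that {alpha < kappa : Q (alpha, A ∩ alpha)} is in U if and only if
   Q (kappa, A) holds; this yields (4), and (3) from (1) and (2).

   For (2), suppose that kappa has a family X not in Ult(M, mu) for any normal mu.
   Choose such a counterexample f(alpha) at every alpha < kappa that has one; then
   X' = j(f)(kappa) is again a counterexample at kappa, but X' is in Ult(M, U),
   where f represents it. The same argument shows that any family of normal
   measures on kappa indexed by P(kappa) has a common upper bound in the Mitchell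
   order, so that o(kappa) is at least (2^kappa)^+.

   Conversely the Mitchell order is transitive, hence the rank of nu is the set of
   the ranks of its predecessors, and there are at most 2^kappa of these, because
   they are represented modulo nu by functions from kappa to kappa. *)

(* The map [j] is not assumed definable in [M], so a construction inside [M] may use only its values
   at single sets, as parameters. Hence every transfer goes through [dfn j P P'], where [P'] is the
   definition of [P] with its parameters moved by [j], and separation and replacement are used for
   definable predicates only. Since the theorem concerns families of subsets of kappa, the full
   theorem of Łoś is replaced by a direct description of such elements of the ultrapower by
   functions on kappa. Two facts behind the overview need their own proofs. The Mitchell rank exists
   because the Mitchell order is well-founded; this is shown without iterated ultrapowers, by
   induction on ordinals for a coarser order on families with the countable intersection property.
   Replacing families of subsets of alpha by indices below kappa needs P(P(alpha)) to have size less
   than kappa: otherwise an enumeration of it, moved by [j] and evaluated at kappa, would put kappa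
   in the range of [j]. *)
From Stdlib Require Import Arith Lia Classical ClassicalEpsilon Wellfounded.
Require Import Defs.

Set Implicit Arguments.
Unset Strict Implicit.
Unset Printing Implicit Defensive.

(** * Definability *)

Section Definability.
Variable D : structure.

(** De Bruijn formulas with elements of the model as constants: parameters belong to the formula,
    where [bmap] can move them by [j]. *)
Inductive term : Type := Var (n : nat) | Cst (c : D).

Inductive bform : Type :=
| BMem (t u : term)
| BEq (t u : term)
| BNot (a : bform)
| BAnd (a b : bform)
| BAll (a : bform).

Definition tev (s : nat -> D) (t : term) : D :=
  match t with Var n => s n | Cst c => c end.

Definition scons (d : D) (s : nat -> D) : nat -> D :=
  fun n => match n with 0 => d | S n => s n end.

Fixpoint bsat (a : bform) (s : nat -> D) : Prop :=
  match a with
  | BMem t u => tev s t ∈ tev s u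
  | BEq t u => tev s t = tev s u
  | BNot a => ~ bsat a s
  | BAnd a b => bsat a s /\ bsat b s
  | BAll a => forall d, bsat a (scons d s)
  end.

Definition tmap (j : D -> D) (t : term) : term :=
  match t with Var n => Var n | Cst c => Cst (j c) end.

Fixpoint bmap (j : D -> D) (a : bform) : bform :=
  match a with
  | BMem t u => BMem (tmap j t) (tmap j u)
  | BEq t u => BEq (tmap j t) (tmap j u)
  | BNot a => BNot (bmap j a)
  | BAnd a b => BAnd (bmap j a) (bmap j b)
  | BAll a => BAll (bmap j a)
  end.

Definition tren (r : nat -> nat) (t : term) : term :=
  match t with Var n => Var (r n) | Cst c => Cst c end.

Definition lift (r : nat -> nat) (n : nat) : nat :=
  match n with 0 => 0 | S n => S (r n) end.

Fixpoint bren (r : nat -> nat) (a : bform) : bform :=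
  match a with
  | BMem t u => BMem (tren r t) (tren r u)
  | BEq t u => BEq (tren r t) (tren r u)
  | BNot a => BNot (bren r a)
  | BAnd a b => BAnd (bren r a) (bren r b)
  | BAll a => BAll (bren (lift r) a)
  end.

Lemma tev_tren r t s s' : (forall n, s' n = s (r n)) -> tev s (tren r t) = tev s' t.
Proof. intros H; destruct t; simpl; auto. Qed.

Lemma bsat_bren a : forall r s s', (forall n, s' n = s (r n)) ->
  (bsat (bren r a) s <-> bsat a s').
Proof.
  induction a as [t u|t u|a IH|a IHa b IHb|a IH]; intros r s s' H; simpl.
  - rewrite !(tev_tren _ H); tauto.
  - rewrite !(tev_tren _ H); tauto.
  - rewrite (IH _ _ _ H); tauto.
  - rewrite (IHa _ _ _ H), (IHb _ _ _ H); tauto.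
  - assert (E : forall d n, scons d s' n = scons d s (lift r n))
      by (intros d [|n]; simpl; auto).
    split; intros K d; apply (IH _ _ _ (E d)); auto.
Qed.

Lemma bmap_bren j a : forall r, bmap j (bren r a) = bren r (bmap j a).
Proof.
  induction a as [t u|t u|a IH|a IHa b IHb|a IH]; intros r; simpl.
  - destruct t, u; reflexivity.
  - destruct t, u; reflexivity.
  - now rewrite IH.
  - now rewrite IHa, IHb.
  - now rewrite IH.
Qed.

(* Translation to named formulas: the free variables 0, 1, 2, ... get the names
   0, 1, 4, 7, ..., the binder at level l gets 3 l + 2, and the m-th constant is
   replaced by the variable 3 m + 3. *)
Definition name (k i : nat) : nat :=
  if i <? k then 3 * (k - 1 - i) + 2
  else match i - k with 0 => 0 | S n => 3 * n + 1 end.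

Definition tname (k : nat) (p : nat -> nat) (t : term) (m : nat) : nat :=
  match t with Var i => name k i | Cst _ => 3 * p m + 3 end.

(** [p] sends the slot of a constant in the current subformula to its slot in the whole formula. An
    atom uses slots 0 and 1; a conjunction gives the even slots to its left half and the odd ones to
    its right half, so distinct occurrences get distinct variables. *)
Fixpoint tr (k : nat) (p : nat -> nat) (a : bform) : formula :=
  match a with
  | BMem t u => fMem (tname k p t 0) (tname k p u 1)
  | BEq t u => fEq (tname k p t 0) (tname k p u 1)
  | BNot a => fNot (tr k p a)
  | BAnd a b => fAnd (tr k (fun m => p (2 * m)) a) (tr k (fun m => p (S (2 * m))) b)
  | BAll a => fAll (3 * k + 2) (tr (S k) p a)
  end.

Definition tpar (t : term) : option D :=
  match t with Var _ => None | Cst c => Some c end.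

Fixpoint par (a : bform) (m : nat) : option D :=
  match a with
  | BMem t u | BEq t u =>
      match m with 0 => tpar t | 1 => tpar u | _ => None end
  | BNot a => par a m
  | BAnd a b => if Nat.even m then par a (Nat.div2 m) else par b (Nat.div2 m)
  | BAll a => par a m
  end.

Lemma sat_tr a : forall k p s e,
  (forall i, e i = s (name k i)) ->
  (forall m c, par a m = Some c -> s (3 * p m + 3) = c) ->
  (sat (tr k p a) s <-> bsat a e).
Proof.
  assert (T : forall k p s e t m, (forall i, e i = s (name k i)) ->
    (forall c, tpar t = Some c -> s (3 * p m + 3) = c) -> s (tname k p t m) = tev e t).
  { intros k p s e [i|c] m H1 H2; cbn [tname tev]; [now rewrite H1 | now apply H2]. }
  induction a as [t u|t u|a IH|a IHa b IHb|a IH]; intros k p s e H1 H2; cbn [tr sat bsat].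
  - now rewrite (T k p s e t 0 H1 (H2 0)), (T k p s e u 1 H1 (H2 1)).
  - now rewrite (T k p s e t 0 H1 (H2 0)), (T k p s e u 1 H1 (H2 1)).
  - rewrite (IH k p s e H1 H2); tauto.
  - rewrite (IHa k (fun m => p (2 * m)) s e H1), (IHb k (fun m => p (S (2 * m))) s e H1); [tauto| |].
    + intros m c E. apply H2. cbn [par].
      rewrite Nat.even_succ, <- Nat.negb_even.
      replace (Nat.even (2 * m)) with true by (symmetry; apply Nat.even_spec; now exists m).
      cbn [negb]. now rewrite Nat.div2_succ_double.
    + intros m c E. apply H2. cbn [par].
      replace (Nat.even (2 * m)) with true by (symmetry; apply Nat.even_spec; now exists m).
      now rewrite Nat.div2_double.
  (* Residues modulo 3 separate bound, free and constant names, and levels separate the binders, so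
     the update at [3 * k + 2] changes index 0 only. *)
  - assert (E : forall d, sat (tr (S k) p a) (upd s (3 * k + 2) d) <-> bsat a (scons d e)).
    { intros d. apply IH.
      - unfold upd, name; intros [|i]; cbn [scons].
        + replace (0 <? S k) with true by (symmetry; apply Nat.ltb_lt; lia).
          replace (S k - 1 - 0) with k by lia. now rewrite Nat.eqb_refl.
        + rewrite H1. unfold name.
          change (S i <? S k) with (i <? k).
          replace (S k - 1 - S i) with (k - 1 - i) by lia.
          replace (S i - S k) with (i - k) by lia.
          destruct (Nat.ltb_spec i k).
          * destruct (Nat.eqb_spec (3 * (k - 1 - i) + 2) (3 * k + 2)); [lia|reflexivity].
          * destruct (i - k) as [|n].
            -- destruct (Nat.eqb_spec 0 (3 * k + 2)); [lia|reflexivity].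
            -- destruct (Nat.eqb_spec (3 * n + 1) (3 * k + 2)); [lia|reflexivity].
      - intros m c Hm. unfold upd.
        destruct (Nat.eqb_spec (3 * p m + 3) (3 * k + 2)); [lia|]. now apply H2. }
    split; intros K d; apply E; auto.
Qed.

(** The inverse of the naming scheme. Names of bound variables get the default [e 0]; such a name is
    updated before it is read. *)
Definition assignment (a : bform) (e : nat -> D) (n : nat) : D :=
  match n with
  | 0 => e 0
  | S n' =>
      let i := n' / 3 in
      match n' mod 3 with
      | 0 => e (S i)
      | 1 => e 0
      | _ => match par a i with Some c => c | None => e 0 end
      end
  end.

Lemma assignment_free a e i : assignment a e (name 0 i) = e i.
Proof.
  destruct i as [|n]; [reflexivity|]. change (name 0 (S n)) with (3 * n + 1).
  replace (3 * n + 1) with (S (n * 3)) by lia. unfold assignment.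
  now rewrite Nat.Div0.mod_mul, Nat.div_mul by lia.
Qed.

Lemma assignment_par a e m c : par a m = Some c -> assignment a e (3 * m + 3) = c.
Proof.
  intros H. replace (3 * m + 3) with (S (2 + m * 3)) by lia. unfold assignment.
  rewrite Nat.Div0.mod_add, Nat.div_add by lia. simpl. now rewrite H.
Qed.

Lemma sat_assignment a e : sat (tr 0 (fun m => m) a) (assignment a e) <-> bsat a e.
Proof.
  apply sat_tr.
  - intros i; symmetry; apply assignment_free.
  - intros m c; apply assignment_par.
Qed.

Lemma par_bmap j a : forall m, par (bmap j a) m = option_map j (par a m).
Proof.
  assert (T : forall t, tpar (tmap j t) = option_map j (tpar t)) by now destruct t.
  induction a as [t u|t u|a IH|a IHa b IHb|a IH]; intros m; simpl; auto.
  - destruct m as [|[|m]]; auto.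
  - destruct m as [|[|m]]; auto.
  - destruct (Nat.even m); auto.
Qed.

Lemma tr_bmap j a : forall k p, tr k p (bmap j a) = tr k p a.
Proof.
  induction a as [t u|t u|a IH|a IHa b IHb|a IH]; intros k p; simpl.
  - now destruct t, u.
  - now destruct t, u.
  - now rewrite IH.
  - now rewrite IHa, IHb.
  - now rewrite IH.
Qed.

(** [tr] forgets which constants occur, so a formula and its image under [bmap j] have the same
    translation. Only the assignment changes, and there elementarity of [j] applies. *)
Lemma elementary_bsat j a e : elementary j ->
  (bsat a e <-> bsat (bmap j a) (fun n => j (e n))).
Proof.
  intros Hj. rewrite <- sat_assignment, (Hj _ (assignment a e)).
  rewrite <- (tr_bmap j). apply sat_tr.
  - intros i; now rewrite assignment_free.
  - intros m c H. rewrite par_bmap in H. destruct (par a m) as [d|] eqn:E; [|discriminate].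
    injection H as <-. f_equal. now apply assignment_par.
Qed.

(* [dfn j P P']: the relation P is definable from parameters, and P' is given by
   the same definition with every parameter c replaced by j c. *)
Definition dfn (j : D -> D) (P P' : (nat -> D) -> Prop) : Prop :=
  exists a, (forall s, P s <-> bsat a s) /\ (forall s, P' s <-> bsat (bmap j a) s).

Lemma dfn_transfer j P P' s : elementary j -> dfn j P P' ->
  (P s <-> P' (fun n => j (s n))).
Proof.
  intros Hj [a [H1 H2]]. rewrite H1, H2. now apply elementary_bsat.
Qed.

Variable j : D -> D.

Lemma dfn_ext P P' Q Q' : (forall s, P s <-> Q s) -> (forall s, P' s <-> Q' s) ->
  dfn j P P' -> dfn j Q Q'.
Proof.
  intros H1 H2 [a [K1 K2]]. exists a. split; intros s.
  - now rewrite <- H1.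
  - now rewrite <- H2.
Qed.

Lemma dfn_not P P' : dfn j P P' -> dfn j (fun s => ~ P s) (fun s => ~ P' s).
Proof.
  intros [a [K1 K2]]. exists (BNot a). split; intros s; simpl.
  - now rewrite K1.
  - now rewrite K2.
Qed.

Lemma dfn_and P P' Q Q' : dfn j P P' -> dfn j Q Q' ->
  dfn j (fun s => P s /\ Q s) (fun s => P' s /\ Q' s).
Proof.
  intros [a [K1 K2]] [b [L1 L2]]. exists (BAnd a b). split; intros s; simpl.
  - now rewrite K1, L1.
  - now rewrite K2, L2.
Qed.

Lemma dfn_or P P' Q Q' : dfn j P P' -> dfn j Q Q' ->
  dfn j (fun s => P s \/ Q s) (fun s => P' s \/ Q' s).
Proof.
  intros HP HQ.
  apply dfn_ext with (3 := dfn_not (dfn_and (dfn_not HP) (dfn_not HQ))); intros s; tauto.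
Qed.

Lemma dfn_imp P P' Q Q' : dfn j P P' -> dfn j Q Q' ->
  dfn j (fun s => P s -> Q s) (fun s => P' s -> Q' s).
Proof.
  intros HP HQ.
  apply dfn_ext with (3 := dfn_not (dfn_and HP (dfn_not HQ))); intros s; tauto.
Qed.

Lemma dfn_iff P P' Q Q' : dfn j P P' -> dfn j Q Q' ->
  dfn j (fun s => P s <-> Q s) (fun s => P' s <-> Q' s).
Proof.
  intros HP HQ. unfold iff. apply dfn_and; apply dfn_imp; assumption.
Qed.

Lemma dfn_all (P P' : (nat -> D) -> D -> Prop) :
  dfn j (fun s => P (fun n => s (S n)) (s 0)) (fun s => P' (fun n => s (S n)) (s 0)) ->
  dfn j (fun s => forall d, P s d) (fun s => forall d, P' s d).
Proof.
  intros [a [K1 K2]]. exists (BAll a). split; intros s; simpl.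
  - split; intros H d; [apply K1|apply (K1 (scons d s))]; auto.
    apply H.
  - split; intros H d; [apply K2|apply (K2 (scons d s))]; auto.
    apply H.
Qed.

Lemma dfn_ex (P P' : (nat -> D) -> D -> Prop) :
  dfn j (fun s => P (fun n => s (S n)) (s 0)) (fun s => P' (fun n => s (S n)) (s 0)) ->
  dfn j (fun s => exists d, P s d) (fun s => exists d, P' s d).
Proof.
  intros H. assert (K := dfn_not (@dfn_all (fun s d => ~ P s d) (fun s d => ~ P' s d) (dfn_not H))).
  revert K. apply dfn_ext; intros s; split; intros K.
  - apply NNPP; intros N; apply K; intros d L; apply N; now exists d.
  - intros N. destruct K as [d L]. now apply (N d).
  - apply NNPP; intros N; apply K; intros d L; apply N; now exists d.
  - intros N. destruct K as [d L]. now apply (N d).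
Qed.

Lemma dfn_ren P P' r : dfn j P P' ->
  dfn j (fun s => P (fun n => s (r n))) (fun s => P' (fun n => s (r n))).
Proof.
  intros [a [K1 K2]]. exists (bren r a). split; intros s.
  - rewrite K1. symmetry. now apply bsat_bren.
  - rewrite K2, bmap_bren. symmetry. now apply bsat_bren.
Qed.

Definition dterm (t t' : (nat -> D) -> D) : Prop :=
  dfn j (fun s => s 0 = t (fun n => s (S n))) (fun s => s 0 = t' (fun n => s (S n))).

Lemma dterm_var i : dterm (fun s => s i) (fun s => s i).
Proof. exists (BEq (Var 0) (Var (S i))). split; intros s; simpl; tauto. Qed.

Lemma dterm_cst c : dterm (fun _ => c) (fun _ => j c).
Proof. exists (BEq (Var 0) (Cst c)). split; intros s; simpl; tauto. Qed.

Lemma dterm_ren t t' r : dterm t t' ->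
  dterm (fun s => t (fun n => s (r n))) (fun s => t' (fun n => s (r n))).
Proof. intros H. exact (dfn_ren (lift r) H). Qed.

(** Notions registered in these classes are atoms for the [dfn] tactic: each is shown definable
    once, without unfolding it at every use. *)
Class Rel1 (P P' : D -> Prop) : Prop :=
  rel1 : dfn j (fun s => P (s 0)) (fun s => P' (s 0)).
Class Rel2 (P P' : D -> D -> Prop) : Prop :=
  rel2 : dfn j (fun s => P (s 0) (s 1)) (fun s => P' (s 0) (s 1)).
Class Rel3 (P P' : D -> D -> D -> Prop) : Prop :=
  rel3 : dfn j (fun s => P (s 0) (s 1) (s 2)) (fun s => P' (s 0) (s 1) (s 2)).
Class Rel4 (P P' : D -> D -> D -> D -> Prop) : Prop :=
  rel4 : dfn j (fun s => P (s 0) (s 1) (s 2) (s 3)) (fun s => P' (s 0) (s 1) (s 2) (s 3)).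
Class Fun1 (F F' : D -> D) : Prop :=
  fun1 : dfn j (fun s => s 0 = F (s 1)) (fun s => s 0 = F' (s 1)).
Class Fun2 (F F' : D -> D -> D) : Prop :=
  fun2 : dfn j (fun s => s 0 = F (s 1) (s 2)) (fun s => s 0 = F' (s 1) (s 2)).

(* Substitution: P (t s) is read as "exists y, y = t s and P y". *)
Lemma dfn_subst (P P' : (nat -> D) -> D -> Prop) t t' :
  dterm t t' ->
  dfn j (fun s => P (fun n => s (S n)) (s 0)) (fun s => P' (fun n => s (S n)) (s 0)) ->
  dfn j (fun s => P s (t s)) (fun s => P' s (t' s)).
Proof.
  intros Ht HP.
  assert (K := @dfn_ex (fun s y => y = t s /\ P s y) (fun s y => y = t' s /\ P' s y) (dfn_and Ht HP)).
  revert K. apply dfn_ext; intros s; split.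
  - intros [y [-> H]]; exact H.
  - intros H; now exists (t s).
  - intros [y [-> H]]; exact H.
  - intros H; now exists (t' s).
Qed.

Lemma dfn_rel1 P P' t t' : Rel1 P P' -> dterm t t' ->
  dfn j (fun s => P (t s)) (fun s => P' (t' s)).
Proof.
  intros HP Ht. exact (@dfn_subst (fun _ => P) (fun _ => P') t t' Ht HP).
Qed.

Lemma dfn_rel2 P P' t t' u u' : Rel2 P P' -> dterm t t' -> dterm u u' ->
  dfn j (fun s => P (t s) (u s)) (fun s => P' (t' s) (u' s)).
Proof.
  intros HP Ht Hu.
  apply (@dfn_subst (fun s y => P (t s) y) (fun s y => P' (t' s) y) u u' Hu).
  apply (@dfn_subst (fun s x => P x (s 0))
    (fun s x => P' x (s 0))
    (fun s => t (fun n => s (S n)))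
    (fun s => t' (fun n => s (S n)))).
  - exact (dterm_ren S Ht).
  - exact HP.
Qed.

Lemma dfn_rel3 P P' t t' u u' v v' : Rel3 P P' -> dterm t t' -> dterm u u' -> dterm v v' ->
  dfn j (fun s => P (t s) (u s) (v s)) (fun s => P' (t' s) (u' s) (v' s)).
Proof.
  intros HP Ht Hu Hv.
  apply (@dfn_subst (fun s z => P (t s) (u s) z) (fun s z => P' (t' s) (u' s) z) v v' Hv).
  apply (@dfn_subst (fun s y => P (t (fun n => s (S n))) y (s 0))
    (fun s y => P' (t' (fun n => s (S n))) y (s 0))
    (fun s => u (fun n => s (S n)))
    (fun s => u' (fun n => s (S n)))).
  - exact (dterm_ren S Hu).
  - apply (@dfn_subst (fun s x => P x (s 0) (s 1))
      (fun s x => P' x (s 0) (s 1))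
      (fun s => t (fun n => s (S (S n))))
      (fun s => t' (fun n => s (S (S n))))).
    + exact (dterm_ren (fun n => S (S n)) Ht).
    + exact HP.
Qed.

Lemma dfn_rel4 P P' t t' u u' v v' w w' :
  Rel4 P P' -> dterm t t' -> dterm u u' -> dterm v v' -> dterm w w' ->
  dfn j (fun s => P (t s) (u s) (v s) (w s)) (fun s => P' (t' s) (u' s) (v' s) (w' s)).
Proof.
  intros HP Ht Hu Hv Hw.
  apply (@dfn_subst (fun s z => P (t s) (u s) (v s) z) (fun s z => P' (t' s) (u' s) (v' s) z) w w' Hw).
  apply (@dfn_subst (fun s z => P (t (fun n => s (S n))) (u (fun n => s (S n))) z (s 0))
    (fun s z => P' (t' (fun n => s (S n))) (u' (fun n => s (S n))) z (s 0))
    (fun s => v (fun n => s (S n)))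
    (fun s => v' (fun n => s (S n)))).
  - exact (dterm_ren S Hv).
  - apply (@dfn_subst (fun s z => P (t (fun n => s (S (S n)))) z (s 0) (s 1))
      (fun s z => P' (t' (fun n => s (S (S n)))) z (s 0) (s 1))
      (fun s => u (fun n => s (S (S n))))
      (fun s => u' (fun n => s (S (S n))))).
    + exact (dterm_ren (fun n => S (S n)) Hu).
    + apply (@dfn_subst (fun s x => P x (s 0) (s 1) (s 2))
        (fun s x => P' x (s 0) (s 1) (s 2))
        (fun s => t (fun n => s (S (S (S n)))))
        (fun s => t' (fun n => s (S (S (S n)))))).
      * exact (dterm_ren (fun n => S (S (S n))) Ht).
      * exact HP.
Qed.

Lemma dterm_fun1 F F' t t' : Fun1 F F' -> dterm t t' ->
  dterm (fun s => F (t s)) (fun s => F' (t' s)).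
Proof.
  intros HF Ht.
  apply (@dfn_rel2 (fun y x => y = F x) (fun y x => y = F' x)); [exact HF| |].
  - apply dterm_var.
  - exact (dterm_ren S Ht).
Qed.

Lemma dterm_fun2 F F' t t' u u' : Fun2 F F' -> dterm t t' -> dterm u u' ->
  dterm (fun s => F (t s) (u s)) (fun s => F' (t' s) (u' s)).
Proof.
  intros HF Ht Hu.
  apply (@dfn_rel3 (fun y x z => y = F x z) (fun y x z => y = F' x z)); [exact HF| | |].
  - apply dterm_var.
  - exact (dterm_ren S Ht).
  - exact (dterm_ren S Hu).
Qed.

#[global] Instance Rel2_mem : Rel2 (@mem D) (@mem D).
Proof. exists (BMem (Var 0) (Var 1)). split; intros s; simpl; tauto. Qed.

#[global] Instance Rel2_eq : Rel2 (@eq D) (@eq D).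
Proof. exists (BEq (Var 0) (Var 1)). split; intros s; simpl; tauto. Qed.

(** The result has no constants, so [bmap j] does not affect it: satisfaction of an arbitrary [phi]
    is a relation that [j] transfers to itself. *)
Fixpoint of_formula (phi : formula) (r : nat -> nat) : bform :=
  match phi with
  | fMem x y => BMem (Var (r x)) (Var (r y))
  | fEq x y => BEq (Var (r x)) (Var (r y))
  | fNot phi => BNot (of_formula phi r)
  | fAnd phi psi => BAnd (of_formula phi r) (of_formula psi r)
  | fAll x phi => BAll (of_formula phi (fun y => if Nat.eqb y x then 0 else S (r y)))
  end.

Lemma bsat_of_formula phi : forall r s e, (forall n, s n = e (r n)) ->
  (bsat (of_formula phi r) e <-> sat phi s) /\
  (bsat (bmap j (of_formula phi r)) e <-> sat phi s).
Proof.
  induction phi as [x y|x y|phi IH|phi IH1 psi IH2|x phi IH]; intros r s e H; simpl.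
  - rewrite !H; tauto.
  - rewrite !H; tauto.
  - specialize (IH r s e H); tauto.
  - specialize (IH1 r s e H); specialize (IH2 r s e H); tauto.
  - assert (E : forall d, forall n, upd s x d n = scons d e (if Nat.eqb n x then 0 else S (r n))).
    { intros d n. unfold upd. destruct (Nat.eqb n x); simpl; auto. }
    split; (split; intros K d; specialize (K d); specialize (IH _ _ _ (E d)); tauto).
Qed.

Lemma Rel1_sat phi : Rel1 (fun x => sat phi (fun _ => x)) (fun x => sat phi (fun _ => x)).
Proof.
  exists (of_formula phi (fun _ => 0)).
  split; intros s; symmetry; now apply bsat_of_formula.
Qed.

(** Free variables from [k] on become constants. Comprehension terms need this: their predicate is
    definable jointly in all environments, whereas separation is applied with one environment
    fixed. *)
Fixpoint bclose (k : nat) (e : nat -> D) (a : bform) : bform :=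
  let close t := match t with
    | Var i => if i <? k then Var i else Cst (e (i - k)) | Cst c => Cst c end in
  match a with
  | BMem t u => BMem (close t) (close u)
  | BEq t u => BEq (close t) (close u)
  | BNot a => BNot (bclose k e a)
  | BAnd a b => BAnd (bclose k e a) (bclose k e b)
  | BAll a => BAll (bclose (S k) e a)
  end.

Lemma bsat_bclose e a : forall k s s',
  (forall i, s' i = if i <? k then s i else e (i - k)) ->
  (bsat (bclose k e a) s <-> bsat a s').
Proof.
  assert (T : forall k s s' t, (forall i, s' i = if i <? k then s i else e (i - k)) ->
    tev s (match t with
      | Var i => if i <? k then Var i else Cst (e (i - k)) | Cst c => Cst c end) = tev s' t).
  { intros k s s' [i|c] H; simpl; auto. rewrite H. now destruct (i <? k). }
  induction a as [t u|t u|a IH|a IHa b IHb|a IH]; intros k s s' H; cbn [bclose bsat].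
  - rewrite !(T k s s' _ H); tauto.
  - rewrite !(T k s s' _ H); tauto.
  - rewrite (IH _ _ _ H); tauto.
  - rewrite (IHa _ _ _ H), (IHb _ _ _ H); tauto.
  - assert (E : forall d i, scons d s' i = if i <? S k then scons d s i else e (i - S k)).
    { intros d [|i]; [reflexivity|]. simpl. apply H. }
    split; intros K d; apply (IH _ _ _ (E d)); auto.
Qed.

End Definability.

(** * Definability from parameters, separation and replacement *)

Lemma bmap_id (D : structure) (a : bform D) : bmap (fun x => x) a = a.
Proof.
  induction a as [t u|t u|a IH|a IHa b IHb|a IH]; simpl.
  - now destruct t, u.
  - now destruct t, u.
  - now rewrite IH.
  - now rewrite IHa, IHb.
  - now rewrite IH.
Qed.

(** With the identity as [j], [dfn] says only that a relation is definable from parameters. *)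
Notation dfn0 P := (dfn (fun x => x) P P).

Lemma dfn_left (D : structure) (j : D -> D) P P' : dfn j P P' -> dfn0 P.
Proof. intros [a [H1 H2]]. exists a. rewrite bmap_id. now split. Qed.

Lemma dfn_right (D : structure) (j : D -> D) P P' : dfn j P P' -> dfn0 P'.
Proof. intros [a [H1 H2]]. exists (bmap j a). rewrite bmap_id. now split. Qed.

Notation def1 P := (Rel1 (fun x => x) P P).
Notation def2 P := (Rel2 (fun x => x) P P).

Lemma dfn0_instance (D : structure) (P : (nat -> D) -> D -> Prop) (e : nat -> D) :
  dfn0 (fun s => P (fun n => s (S n)) (s 0)) -> def1 (P e).
Proof.
  intros [a [H _]].
  assert (K : forall s, P e (s 0) <-> bsat (bclose 1 e a) s).
  { intros s. rewrite (@bsat_bclose _ e a 1 s (scons (s 0) e)).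
    - apply (H (scons (s 0) e)).
    - intros [|i]; [reflexivity|]. simpl. now rewrite Nat.sub_0_r. }
  exists (bclose 1 e a). rewrite bmap_id. now split.
Qed.

Lemma def1_separation (D : structure) (Z : ZFC D) (P : D -> Prop) (x : D) :
  def1 P -> exists y, forall z, z ∈ y <-> z ∈ x /\ P z.
Proof.
  intros [a [H _]].
  destruct (separation Z (tr 0 (fun m => m) a) (assignment a (fun _ => x)) x) as [y Hy].
  exists y. intros z. rewrite Hy. apply and_iff_compat_l.
  rewrite (H (scons z (fun _ => x))). apply sat_tr.
  - intros [|i]; unfold upd.
    + reflexivity.
    + destruct (Nat.eqb_spec (name 0 (S i)) 0) as [E|E].
      * unfold name in E; simpl in E; lia.
      * now rewrite assignment_free.
  - intros m c Hm. unfold upd.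
    destruct (Nat.eqb_spec (3 * m + 3) 0) as [E|E]; [lia|now apply assignment_par].
Qed.

Lemma def2_replacement (D : structure) (Z : ZFC D) (R : D -> D -> Prop) (x : D) :
  def2 R -> (forall z, z ∈ x -> exists! w, R z w) ->
  exists y, forall w, w ∈ y <-> exists z, z ∈ x /\ R z w.
Proof.
  intros [a [H _]] Hx.
  assert (E : forall z w, sat (tr 0 (fun m => m) a)
      (upd (upd (assignment a (fun _ => x)) 0 z) 1 w) <-> R z w).
  { intros z w. rewrite (H (scons z (scons w (fun _ => x)))). apply sat_tr.
    - intros [|[|i]]; unfold upd; try reflexivity.
      destruct (Nat.eqb_spec (name 0 (S (S i))) 1) as [E|E];
        [unfold name in E; simpl in E; lia|].
      destruct (Nat.eqb_spec (name 0 (S (S i))) 0) as [F|F];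
        [unfold name in F; simpl in F; lia|].
      now rewrite assignment_free.
    - intros m c Hm. unfold upd.
      destruct (Nat.eqb_spec (3 * m + 3) 1) as [F|F]; [lia|].
      destruct (Nat.eqb_spec (3 * m + 3) 0) as [F'|F']; [lia|].
      now apply assignment_par. }
  destruct (replacement Z (phi := tr 0 (fun m => m) a)
    (s := assignment a (fun _ => x)) (x := x)) as [y Hy].
  - intros z Hz. destruct (Hx z Hz) as [w [Hw U]]. exists w. split.
    + now apply E.
    + intros w' Hw'. apply U. now apply E.
  - exists y. intros w. rewrite Hy. split; intros [z [Hz Hw]]; exists z; split; auto; now apply E.
Qed.

(* Extended below to comprehension terms. *)
Ltac dterm_comprehension := fail.

(** Recursion on the shape of the first relation; the second follows by unification. [measure_one]
    and [is_strict_sup] are unfolded because they take predicates as arguments and so cannot be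
    registered as atoms. *)
Ltac dfn_step :=
  cbv beta;
  lazymatch goal with
  | |- Rel1 _ _ _ => unfold Rel1
  | |- Rel2 _ _ _ => unfold Rel2
  | |- Rel3 _ _ _ => unfold Rel3
  | |- Rel4 _ _ _ => unfold Rel4
  | |- Fun1 _ _ _ => unfold Fun1
  | |- Fun2 _ _ _ => unfold Fun2
  | |- dfn _ (fun s => forall d : dom _, _) _ => eapply dfn_all
  | |- dfn _ (fun s => exists! d : dom _, _) _ => unfold unique
  | |- dfn _ (fun s => exists d : dom _, _) _ => eapply dfn_ex
  | |- dfn _ (fun s => ~ _) _ => eapply dfn_not
  | |- dfn _ (fun s => _ /\ _) _ => eapply dfn_and
  | |- dfn _ (fun s => _ \/ _) _ => eapply dfn_or
  | |- dfn _ (fun s => _ <-> _) _ => eapply dfn_iff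
  | |- dfn _ (fun s => _ -> _) _ => eapply dfn_imp
  | |- dfn _ (fun s => measure_one _ _ _) _ => unfold measure_one
  | |- dfn _ (fun s => is_strict_sup _ _) _ => unfold is_strict_sup
  | |- dfn _ _ _ =>
      first [ eapply dfn_rel4; [typeclasses eauto| | | |]
            | eapply dfn_rel3; [typeclasses eauto| | |]
            | eapply dfn_rel2; [typeclasses eauto| |]
            | eapply dfn_rel1; [typeclasses eauto|] ]
  | |- dterm _ (fun s => s ?i) _ => eapply (dterm_var _ i)
  | |- dterm _ _ _ =>
      first [ eapply dterm_cst
            | dterm_comprehension
            | eapply dterm_fun2; [typeclasses eauto| |]
            | eapply dterm_fun1; [typeclasses eauto|] ]
  end.
Ltac dfn := intros; repeat dfn_step.

(** * Definability of the set-theoretic notions *)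

Section DefinableNotions.
Variables (D : structure) (j : D -> D).

#[global] Instance Rel2_subset : Rel2 j (@subset D) (@subset D).
Proof. unfold subset; dfn. Qed.
#[global] Instance Rel2_is_powerset : Rel2 j (@is_powerset D) (@is_powerset D).
Proof. unfold is_powerset; dfn. Qed.
#[global] Instance Rel3_is_inter : Rel3 j (@is_inter D) (@is_inter D).
Proof. unfold is_inter; dfn. Qed.
#[global] Instance Rel3_is_upair : Rel3 j (@is_upair D) (@is_upair D).
Proof. unfold is_upair; dfn. Qed.
#[global] Instance Rel3_is_opair : Rel3 j (@is_opair D) (@is_opair D).
Proof. unfold is_opair; dfn. Qed.
#[global] Instance Rel3_app : Rel3 j (@app D) (@app D).
Proof. unfold app; dfn. Qed.
#[global] Instance Rel2_is_fun : Rel2 j (@is_fun D) (@is_fun D).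
Proof. unfold is_fun; dfn. Qed.
#[global] Instance Rel3_is_fun_into : Rel3 j (@is_fun_into D) (@is_fun_into D).
Proof. unfold is_fun_into; dfn. Qed.
#[global] Instance Rel3_is_bijection : Rel3 j (@is_bijection D) (@is_bijection D).
Proof. unfold is_bijection; dfn. Qed.
#[global] Instance Rel2_equinumerous : Rel2 j (@equinumerous D) (@equinumerous D).
Proof. unfold equinumerous; dfn. Qed.
#[global] Instance Rel1_is_ordinal : Rel1 j (@is_ordinal D) (@is_ordinal D).
Proof. unfold is_ordinal; dfn. Qed.
#[global] Instance Rel1_is_cardinal : Rel1 j (@is_cardinal D) (@is_cardinal D).
Proof. unfold is_cardinal; dfn. Qed.
#[global] Instance Rel2_is_cardinality_of :
  Rel2 j (@is_cardinality_of D) (@is_cardinality_of D).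
Proof. unfold is_cardinality_of; dfn. Qed.
#[global] Instance Rel2_is_succ_cardinal :
  Rel2 j (@is_succ_cardinal D) (@is_succ_cardinal D).
Proof. unfold is_succ_cardinal; dfn. Qed.
#[global] Instance Rel2_normal_measure : Rel2 j (@normal_measure D) (@normal_measure D).
Proof.
  unfold normal_measure, is_ultrafilter, is_nonprincipal, is_complete, is_normal; dfn.
Qed.
#[global] Instance Rel4_ult_eq : Rel4 j (@ult_eq D) (@ult_eq D).
Proof. unfold ult_eq; dfn. Qed.
#[global] Instance Rel4_ult_mem : Rel4 j (@ult_mem D) (@ult_mem D).
Proof. unfold ult_mem; dfn. Qed.
#[global] Instance Rel4_ult_collapse : Rel4 j (@ult_collapse D) (@ult_collapse D).
Proof. unfold ult_collapse; dfn. Qed.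
#[global] Instance Rel3_in_Ult : Rel3 j (@in_Ult D) (@in_Ult D).
Proof. unfold in_Ult; dfn. Qed.
#[global] Instance Rel3_mitchell_lt : Rel3 j (@mitchell_lt D) (@mitchell_lt D).
Proof. unfold mitchell_lt; dfn. Qed.
#[global] Instance Rel2_is_mitchell_rank :
  Rel2 j (@is_mitchell_rank D) (@is_mitchell_rank D).
Proof. unfold is_mitchell_rank; dfn. Qed.
#[global] Instance Rel2_is_mitchell_order :
  Rel2 j (@is_mitchell_order D) (@is_mitchell_order D).
Proof. unfold is_mitchell_order; dfn. Qed.
#[global] Instance Rel1_mitchell_order_eq_succ_pow :
  Rel1 j (@mitchell_order_eq_succ_pow D) (@mitchell_order_eq_succ_pow D).
Proof. unfold mitchell_order_eq_succ_pow; dfn. Qed.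
#[global] Instance Rel1_every_subset_of_powerset_in_Ult :
  Rel1 j (@every_subset_of_powerset_in_Ult D) (@every_subset_of_powerset_in_Ult D).
Proof. unfold every_subset_of_powerset_in_Ult; dfn. Qed.

End DefinableNotions.

(** * Sets in a model of ZFC *)

Existing Class ZFC.

Definition the (D : structure) (d : D) (P : D -> Prop) : D := epsilon (inhabits d) P.

Lemma the_spec (D : structure) (P : D -> Prop) (d : D) : (exists x, P x) -> P (the d P).
Proof. apply epsilon_spec. Qed.

Section BasicSets.
Context {D : structure}.
Implicit Types (a b c d f g o p r x y z A : D) (P Q : D -> Prop).

Definition upair x y := the x (fun z => is_upair z x y).
Definition pair x y := the x (fun p => is_opair p x y).
Definition bigunion x := the x (fun u => forall z, z ∈ u <-> exists y, y ∈ x /\ z ∈ y).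
Definition power x := the x (fun p => is_powerset p x).
Definition cmp x P := the x (fun y => forall z, z ∈ y <-> z ∈ x /\ P z).
Definition inter x y := cmp x (fun z => z ∈ y).
Definition cart x y := cmp (power (power (bigunion (upair x y))))
  (fun p => exists a b, a ∈ x /\ b ∈ y /\ p = pair a b).
(* The union of the values of f at x, hence f(x) when f is a function with x in
   its domain, and the empty set outside the domain. *)
Definition fapp f x := the f (fun y => forall z, z ∈ y <-> exists v, app f x v /\ z ∈ v).
Definition succ x := bigunion (upair x (upair x x)).

Context {Z : ZFC D}.

Lemma ext x y : (forall z, z ∈ x <-> z ∈ y) -> x = y.
Proof. apply (extensionality Z). Qed.

Lemma subset_antisym x y : subset x y -> subset y x -> x = y.
Proof. intros H K; apply ext; split; auto. Qed.

Lemma in_upair x y z : z ∈ upair x y <-> z = x \/ z = y.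
Proof. revert z. apply (the_spec (P := fun z => is_upair z x y)), (pairing Z). Qed.

Lemma in_bigunion x z : z ∈ bigunion x <-> exists y, y ∈ x /\ z ∈ y.
Proof.
  revert z. apply (the_spec (P := fun u => forall z, z ∈ u <-> exists y, y ∈ x /\ z ∈ y)).
  apply (Defs.union Z).
Qed.

Lemma in_power x z : z ∈ power x <-> subset z x.
Proof. revert z. apply (the_spec (P := fun p => is_powerset p x)), (powerset Z). Qed.

Lemma in_cmp x P z : def1 P -> (z ∈ cmp x P <-> z ∈ x /\ P z).
Proof.
  intros H. revert z. apply (the_spec (P := fun y => forall z, z ∈ y <-> z ∈ x /\ P z)).
  now apply def1_separation.
Qed.

Lemma in_inter x y z : z ∈ inter x y <-> z ∈ x /\ z ∈ y.
Proof. unfold inter. rewrite in_cmp; [tauto|dfn]. Qed.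

Lemma in_succ x z : z ∈ succ x <-> z ∈ x \/ z = x.
Proof.
  unfold succ. rewrite in_bigunion. split.
  - intros [y [Hy Hz]]. apply in_upair in Hy as [->| ->]; auto.
    apply in_upair in Hz as [->| ->]; auto.
  - intros [H|H].
    + exists x; split; auto. apply in_upair; auto.
    + exists (upair x x); split; apply in_upair; auto.
Qed.

Lemma upair_graph u x y : is_upair u x y <-> u = upair x y.
Proof.
  split.
  - intros H; apply ext; intros z; now rewrite in_upair.
  - intros -> z; apply in_upair.
Qed.

Lemma opair_graph p x y : is_opair p x y <-> p = pair x y.
Proof.
  assert (K : is_opair (pair x y) x y).
  { unfold pair. apply the_spec. exists (upair (upair x x) (upair x y)).
    exists (upair x x), (upair x y). now rewrite !upair_graph. }
  split; [|now intros ->].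
  destruct K as [a [b [Ha [Hb Hp]]]]. intros [a' [b' [Ha' [Hb' Hp']]]].
  rewrite upair_graph in *. congruence.
Qed.

Lemma pair_eq x y : pair x y = upair (upair x x) (upair x y).
Proof.
  symmetry. apply opair_graph. exists (upair x x), (upair x y). now rewrite !upair_graph.
Qed.

Lemma upair_inj x y x' y' : upair x y = upair x' y' ->
  (x = x' /\ y = y') \/ (x = y' /\ y = x').
Proof.
  intros H.
  assert (E : forall z, (z = x \/ z = y) <-> (z = x' \/ z = y')).
  { intros z. rewrite <- !in_upair. now rewrite H. }
  pose proof (proj1 (E x) (or_introl eq_refl)).
  pose proof (proj1 (E y) (or_intror eq_refl)).
  pose proof (proj2 (E x') (or_introl eq_refl)).
  pose proof (proj2 (E y') (or_intror eq_refl)).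
  intuition congruence.
Qed.

Lemma pair_inj x y x' y' : pair x y = pair x' y' -> x = x' /\ y = y'.
Proof.
  rewrite !pair_eq. intros H.
  destruct (upair_inj H) as [[H1 H2]|[H1 H2]];
    destruct (upair_inj H1); destruct (upair_inj H2); intuition congruence.
Qed.

Lemma app_pair f x y : app f x y <-> pair x y ∈ f.
Proof.
  split.
  - intros [p [Hp E]]. apply opair_graph in E. now subst.
  - intros H; exists (pair x y); split; auto. now apply opair_graph.
Qed.

Lemma in_cart x y p : p ∈ cart x y <-> exists a b, a ∈ x /\ b ∈ y /\ p = pair a b.
Proof.
  unfold cart. rewrite in_cmp.
  - split; [tauto|]. intros H; split; auto.
    destruct H as [a [b [Ha [Hb ->]]]]. rewrite pair_eq.
    assert (a ∈ bigunion (upair x y) /\ b ∈ bigunion (upair x y)) as [Ha' Hb'].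
    { split; apply in_bigunion; [exists x|exists y]; (split; [apply in_upair|]; auto). }
    apply in_power. intros z Hz. apply in_power. intros w Hw.
    apply in_upair in Hz as [->| ->]; apply in_upair in Hw as [->| ->]; auto.
  - eapply dfn_ext with (P := fun s => exists a b, a ∈ x /\ b ∈ y /\ is_opair (s 0) a b)
      (P' := fun s => exists a b, a ∈ x /\ b ∈ y /\ is_opair (s 0) a b); [| |dfn];
    intros s; setoid_rewrite opair_graph; tauto.
Qed.

Lemma pair_in_cart x y a b : pair a b ∈ cart x y <-> a ∈ x /\ b ∈ y.
Proof.
  rewrite in_cart. split.
  - intros [a' [b' [Ha [Hb E]]]]. now apply pair_inj in E as [-> ->].
  - intros [Ha Hb]; now exists a, b.
Qed.

Lemma in_fapp f x z : z ∈ fapp f x <-> exists v, app f x v /\ z ∈ v.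
Proof.
  revert z. apply (the_spec (P := fun y => forall z, z ∈ y <-> exists v, app f x v /\ z ∈ v)).
  (* As v ∈ {x, v} ∈ [pair x v] ∈ f, every element of v lies in the triple union of [f]. *)
  destruct (@def1_separation D Z (fun z => exists v, app f x v /\ z ∈ v)
    (bigunion (bigunion (bigunion f)))) as [y Hy]; [dfn|].
  exists y. intros z. rewrite Hy. split; [tauto|]. intros H; split; auto.
  destruct H as [v [Hv Hz]]. apply in_bigunion. exists v; split; auto.
  apply in_bigunion. exists (upair x v); split; [|apply in_upair; auto].
  apply in_bigunion. exists (pair x v). split; [now apply app_pair|].
  rewrite pair_eq. apply in_upair; auto.
Qed.

Lemma fapp_app f x y : (forall y', app f x y' -> y' = y) -> app f x y -> fapp f x = y.
Proof.
  intros U H. apply ext. intros z. rewrite in_fapp. split.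
  - intros [v [Hv Hz]]. now rewrite <- (U v Hv).
  - intros Hz; now exists y.
Qed.

Lemma app_fun f a x y : is_fun f a -> (app f x y <-> x ∈ a /\ y = fapp f x).
Proof.
  intros [H1 H2]. split.
  - intros H. assert (Hx : x ∈ a).
    { destruct H as [p [Hp E]]. destruct (H1 p Hp) as [x' [y' [Hx' E']]].
      apply opair_graph in E, E'. subst. now apply pair_inj in E' as [-> _]. }
    split; auto. destruct (H2 x Hx) as [y0 [Hy0 U]].
    symmetry. apply fapp_app; auto. intros y' Hy'. now rewrite <- (U y' Hy'), <- (U y H).
  - intros [Hx ->]. destruct (H2 x Hx) as [y0 [Hy0 U]].
    rewrite (fapp_app (y := y0)); auto. intros y' Hy'; symmetry; auto.
Qed.

Lemma fapp_out f a x : is_fun f a -> ~ x ∈ a -> forall z, ~ z ∈ fapp f x.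
Proof.
  intros Hf Hx z Hz. apply in_fapp in Hz as [v [Hv _]].
  apply (app_fun _ _ Hf) in Hv. tauto.
Qed.

Lemma fun_into_fapp f a b x : is_fun_into f a b -> x ∈ a -> fapp f x ∈ b.
Proof. intros [Hf H] Hx. apply (H x). now apply (app_fun _ _ Hf). Qed.

Lemma fun_ext f g a : is_fun f a -> is_fun g a ->
  (forall x, x ∈ a -> fapp f x = fapp g x) -> f = g.
Proof.
  assert (K : forall f g, is_fun f a -> is_fun g a ->
    (forall x, x ∈ a -> fapp f x = fapp g x) -> subset f g).
  { clear f g. intros f g Hf Hg H p Hp.
    destruct (proj1 Hf p Hp) as [x [y [Hx E]]]. apply opair_graph in E as ->.
    apply app_pair in Hp. apply app_pair. rewrite (app_fun _ _ Hf) in Hp.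
    rewrite (app_fun _ _ Hg). rewrite <- H; auto. }
  intros Hf Hg H. apply subset_antisym; apply K; auto. intros x Hx; symmetry; auto.
Qed.

Lemma is_fun_intro f a : (forall p, p ∈ f -> exists x y, x ∈ a /\ p = pair x y) ->
  (forall x, x ∈ a -> exists y, forall y', pair x y' ∈ f <-> y' = y) -> is_fun f a.
Proof.
  intros H1 H2. split.
  - intros p Hp. destruct (H1 p Hp) as [x [y [Hx E]]]. exists x, y.
    split; auto. now apply opair_graph.
  - intros x Hx. destruct (H2 x Hx) as [y Hy]. exists y. split.
    + apply app_pair. now apply Hy.
    + intros y' Hy'. apply app_pair in Hy'. symmetry. now apply Hy.
Qed.

Lemma fun_into_intro f a b : is_fun f a -> (forall x, x ∈ a -> fapp f x ∈ b) ->
  is_fun_into f a b.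
Proof.
  intros Hf H. split; auto. intros x y Hxy. apply (app_fun _ _ Hf) in Hxy as [Hx ->]; auto.
Qed.

Lemma fun_in_power_cart f a b : is_fun_into f a b -> f ∈ power (cart a b).
Proof.
  intros Hf. apply in_power. intros p Hp. destruct Hf as [Hf Hb].
  destruct (proj1 Hf p Hp) as [x [y [Hx E]]]. apply opair_graph in E as ->.
  apply pair_in_cart; split; auto. apply (Hb x). now apply app_pair.
Qed.

Section Instances.
Variable j : D -> D.

#[global] Instance Fun2_upair : Fun2 j upair upair.
Proof.
  unfold Fun2. eapply dfn_ext with (P := fun s => is_upair (s 0) (s 1) (s 2))
    (P' := fun s => is_upair (s 0) (s 1) (s 2)); [..|dfn]; intros s; apply upair_graph.
Qed.
#[global] Instance Fun2_pair : Fun2 j pair pair.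
Proof.
  unfold Fun2. eapply dfn_ext with (P := fun s => is_opair (s 0) (s 1) (s 2))
    (P' := fun s => is_opair (s 0) (s 1) (s 2)); [..|dfn]; intros s; apply opair_graph.
Qed.

Lemma eq_graph y x P : (forall z, z ∈ x <-> P z) -> ((forall z, z ∈ y <-> P z) <-> y = x).
Proof.
  intros H; split.
  - intros K; apply ext; intros z. now rewrite H, K.
  - now intros ->.
Qed.

#[global] Instance Fun1_bigunion : Fun1 j bigunion bigunion.
Proof.
  unfold Fun1. eapply dfn_ext with
    (P := fun s => forall z, z ∈ s 0 <-> exists y, y ∈ s 1 /\ z ∈ y)
    (P' := fun s => forall z, z ∈ s 0 <-> exists y, y ∈ s 1 /\ z ∈ y); [..|dfn];
  intros s; apply eq_graph; intros z; apply in_bigunion.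
Qed.
#[global] Instance Fun1_power : Fun1 j power power.
Proof.
  unfold Fun1. eapply dfn_ext with
    (P := fun s => forall z, z ∈ s 0 <-> subset z (s 1))
    (P' := fun s => forall z, z ∈ s 0 <-> subset z (s 1)); [..|dfn];
  intros s; apply eq_graph; intros z; apply in_power.
Qed.
#[global] Instance Fun1_succ : Fun1 j succ succ.
Proof. unfold succ. dfn. Qed.
#[global] Instance Fun2_inter : Fun2 j inter inter.
Proof.
  unfold Fun2. eapply dfn_ext with
    (P := fun s => forall z, z ∈ s 0 <-> z ∈ s 1 /\ z ∈ s 2)
    (P' := fun s => forall z, z ∈ s 0 <-> z ∈ s 1 /\ z ∈ s 2); [..|dfn];
  intros s; apply eq_graph; intros z; apply in_inter.
Qed.
#[global] Instance Fun2_cart : Fun2 j cart cart.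
Proof.
  unfold Fun2. eapply dfn_ext with
    (P := fun s => forall p, p ∈ s 0 <-> exists a b, a ∈ s 1 /\ b ∈ s 2 /\ p = pair a b)
    (P' := fun s => forall p, p ∈ s 0 <-> exists a b, a ∈ s 1 /\ b ∈ s 2 /\ p = pair a b);
    [..|dfn];
  intros s; apply eq_graph; intros z; apply in_cart.
Qed.
#[global] Instance Fun2_fapp : Fun2 j fapp fapp.
Proof.
  unfold Fun2. eapply dfn_ext with
    (P := fun s => forall z, z ∈ s 0 <-> exists v, app (s 1) (s 2) v /\ z ∈ v)
    (P' := fun s => forall z, z ∈ s 0 <-> exists v, app (s 1) (s 2) v /\ z ∈ v); [..|dfn];
  intros s; apply eq_graph; intros z; apply in_fapp.
Qed.

(* The definition of P is instantiated at each environment s, so that the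
   comprehension exists. *)
Lemma dterm_cmp t t' (P P' : (nat -> D) -> D -> Prop) :
  dterm j t t' ->
  dfn j (fun s => P (fun n => s (S n)) (s 0)) (fun s => P' (fun n => s (S n)) (s 0)) ->
  dterm j (fun s => cmp (t s) (P s)) (fun s => cmp (t' s) (P' s)).
Proof.
  intros Ht HP.
  eapply dfn_ext with
    (P := fun s => forall z, z ∈ s 0 <-> z ∈ t (fun n => s (S n)) /\ P (fun n => s (S n)) z)
    (P' := fun s => forall z, z ∈ s 0 <-> z ∈ t' (fun n => s (S n)) /\ P' (fun n => s (S n)) z).
  - intros s. apply eq_graph. intros z. apply in_cmp.
    exact (dfn0_instance (fun n => s (S n)) (dfn_left HP)).
  - intros s. apply eq_graph. intros z. apply in_cmp.
    exact (dfn0_instance (fun n => s (S n)) (dfn_right HP)).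
  - apply dfn_all. apply dfn_iff; [dfn|]. apply dfn_and.
    + apply dfn_rel2; [typeclasses eauto|dfn|exact (dterm_ren (fun n => S (S n)) Ht)].
    + exact (dfn_ren (lift S) HP).
Qed.
End Instances.

End BasicSets.

Ltac dterm_comprehension ::= eapply dterm_cmp.

(** * Choice for definable relations *)

Section Choice.
Context {D : structure} {Z : ZFC D}.
Implicit Types (a b c d f g o p r x y z A : D).

(** Replacement collects the nonempty sets {y ∈ b : R x y} for x ∈ a; a choice function on this
    collection is composed with the map from x to its set. *)
Lemma bounded_choice a b (R : D -> D -> Prop) : def2 R ->
  (forall x, x ∈ a -> exists y, y ∈ b /\ R x y) ->
  exists f, is_fun_into f a b /\ forall x, x ∈ a -> R x (fapp f x).
Proof.
  intros HR Hab.
  set (B := fun x => cmp b (fun y => R x y)).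
  assert (HB : forall x y, y ∈ B x <-> y ∈ b /\ R x y).
  { intros x y. unfold B. apply (in_cmp b (P := fun y => R x y)). dfn. }
  destruct (@def2_replacement D Z (fun x w => w = B x) a) as [F HF].
  { unfold B. dfn. }
  { intros x Hx. exists (B x). split; auto. }
  destruct (choice Z (x := F)) as [c [Hc1 Hc2]].
  { intros y Hy. apply HF in Hy as [x [Hx ->]]. destruct (Hab x Hx) as [y Hy].
    exists y. now apply HB. }
  assert (V : forall x, x ∈ a -> fapp c (B x) ∈ b /\ R x (fapp c (B x))).
  { intros x Hx. apply HB. assert (B x ∈ F) by (apply HF; now exists x).
    apply (Hc2 (B x)); auto. now apply (app_fun _ _ Hc1). }
  set (f := cmp (cart a b) (fun p => exists x, p = pair x (fapp c (B x)))).
  assert (Hf : forall x y, pair x y ∈ f <-> x ∈ a /\ y = fapp c (B x)).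
  { intros x y. unfold f. rewrite in_cmp by (unfold B; dfn). rewrite pair_in_cart. split.
    - intros [[Hx Hy] [x' E]]. now apply pair_inj in E as [<- ->].
    - intros [Hx ->]. split; [split; auto; now apply V|]. now exists x. }
  assert (Ff : is_fun f a).
  { apply is_fun_intro.
    - intros p Hp. assert (Hp' := Hp). unfold f in Hp. rewrite in_cmp in Hp by (unfold B; dfn).
      destruct Hp as [_ [x ->]]. apply Hf in Hp' as [Hx _]. now exists x, (fapp c (B x)).
    - intros x Hx. exists (fapp c (B x)). intros y. rewrite Hf. tauto. }
  assert (Vf : forall x, x ∈ a -> fapp f x = fapp c (B x)).
  { intros x Hx. assert (K : app f x (fapp c (B x))) by (apply app_pair, Hf; auto).
    apply (app_fun _ _ Ff) in K as [_ K]; auto. }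
  exists f. split.
  - apply fun_into_intro; auto. intros x Hx. rewrite Vf; auto. now apply V.
  - intros x Hx. rewrite Vf; auto. now apply V.
Qed.

Lemma bounded_fun a b (F : D -> D) : Fun1 (fun x => x) F F ->
  (forall x, x ∈ a -> F x ∈ b) ->
  exists f, is_fun_into f a b /\ forall x, x ∈ a -> fapp f x = F x.
Proof.
  intros HF H. destruct (@bounded_choice a b (fun x y => y = F x)) as [f [Hf E]].
  - dfn.
  - intros x Hx; exists (F x); auto.
  - exists f; auto.
Qed.
End Choice.

(** * Ordinals and transfinite recursion *)

Existing Class well_founded.

Section Ordinals.
Context {D : structure} {Z : ZFC D} {W : well_founded (@mem D)}.
Implicit Types (a b c d f g o p q r x y z : D) (P : D -> Prop).

(** Membership is well-founded in the metatheory, so minimal elements exist for arbitrary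
    predicates, definable or not. *)
Lemma epsilon_minimal P : (exists x, P x) -> exists x, P x /\ forall y, y ∈ x -> ~ P y.
Proof.
  intros [x Hx]. induction x as [x IH] using (well_founded_ind W).
  destruct (classic (exists y, y ∈ x /\ P y)) as [[y [Hy K]]|N].
  - exact (IH y Hy K).
  - exists x. split; auto. intros y Hy K. apply N; now exists y.
Qed.

Lemma mem_irrefl x : ~ x ∈ x.
Proof.
  induction x as [x IH] using (well_founded_ind W). intros H. exact (IH x H H).
Qed.

Lemma mem_asym x y : x ∈ y -> ~ y ∈ x.
Proof.
  revert y. induction x as [x IH] using (well_founded_ind W). intros y H K.
  exact (IH y K x K H).
Qed.

Lemma mem_no_cycle3 x y z : x ∈ y -> y ∈ z -> ~ z ∈ x.
Proof.
  intros H K L. destruct (epsilon_minimal (P := fun w => w = x \/ w = y \/ w = z)) as [w [Hw M]].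
  - exists x; auto.
  - destruct Hw as [->|[->| ->]]; [apply (M z)|apply (M x)|apply (M y)]; auto.
Qed.

Lemma ord_trans a x y : is_ordinal a -> x ∈ a -> y ∈ x -> y ∈ a.
Proof. intros [H _] Hx. now apply H. Qed.

Lemma ord_mem a x : is_ordinal a -> x ∈ a -> is_ordinal x.
Proof.
  intros Ha Hx. split.
  - intros y Hy z Hz. assert (Hya := ord_trans Ha Hx Hy). assert (Hza := ord_trans Ha Hya Hz).
    destruct (proj2 Ha x z Hx Hza) as [K|[K|K]]; auto; exfalso.
    + exact (mem_no_cycle3 K Hz Hy).
    + subst z. exact (mem_asym Hz Hy).
  - intros y z Hy Hz. apply (proj2 Ha); eapply ord_trans; eauto.
Qed.

(** The least element of [b] outside [c] is equal to [c]. *)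
Lemma ord_initial_segment b c : is_ordinal b -> (forall x, x ∈ c -> subset x c) ->
  subset c b -> c <> b -> c ∈ b.
Proof.
  intros Hb Hc Hs Hne.
  destruct (epsilon_minimal (P := fun z => z ∈ b /\ ~ z ∈ c)) as [z [[Hz Hzc] M]].
  - apply NNPP; intros N; apply Hne. apply subset_antisym; auto.
    intros z Hz. apply NNPP; intros K; apply N; now exists z.
  - replace c with z; auto. apply subset_antisym; intros w Hw.
    + apply NNPP; intros K. apply (M w); auto. split; auto. eapply ord_trans; eauto.
    + destruct (proj2 Hb w z (Hs w Hw) Hz) as [K|[->|K]]; auto; [tauto|].
      exfalso. apply Hzc. exact (Hc w Hw z K).
Qed.

Lemma ord_subset a b : is_ordinal a -> is_ordinal b -> subset a b -> a = b \/ a ∈ b.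
Proof.
  intros Ha Hb H. destruct (classic (a = b)); auto. right.
  apply ord_initial_segment; auto. apply Ha.
Qed.

Lemma ord_total a b : is_ordinal a -> is_ordinal b -> a ∈ b \/ a = b \/ b ∈ a.
Proof.
  intros Ha Hb.
  assert (T : forall x, x ∈ inter a b -> subset x (inter a b)).
  { intros x Hx y Hy. apply in_inter in Hx as [H1 H2]. apply in_inter.
    split; eapply ord_trans; eauto. }
  assert (S1 : subset (inter a b) a) by (intros x Hx; now apply in_inter in Hx).
  assert (S2 : subset (inter a b) b) by (intros x Hx; now apply in_inter in Hx).
  destruct (classic (inter a b = a)) as [E1|N1].
  - rewrite E1 in S2. destruct (ord_subset Ha Hb S2); auto.
  - destruct (classic (inter a b = b)) as [E2|N2].
    + rewrite E2 in S1. destruct (ord_subset Hb Ha S1); auto.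
    + exfalso. apply (@mem_irrefl (inter a b)). apply in_inter.
      split; apply ord_initial_segment; auto.
Qed.

Lemma ord_not_mem a b : is_ordinal a -> is_ordinal b -> ~ a ∈ b -> subset b a.
Proof.
  intros Ha Hb H. destruct (ord_total Ha Hb) as [K|[->|K]]; [tauto|intros x; auto|].
  now apply Ha.
Qed.

Lemma ord_subset_not_mem a b : subset b a -> ~ a ∈ b.
Proof. intros H K. apply (@mem_irrefl a); auto. Qed.

Lemma least_ordinal P : (exists a, is_ordinal a /\ P a) ->
  exists a, is_ordinal a /\ P a /\ forall b, is_ordinal b -> P b -> subset a b.
Proof.
  intros H. destruct (epsilon_minimal H) as [a [[Ha HP] M]].
  exists a. split; auto. split; auto. intros b Hb K. apply ord_not_mem; auto.
  intros L. apply (M b); auto.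
Qed.

Lemma ord_intro a : (forall x, x ∈ a -> is_ordinal x) -> (forall x, x ∈ a -> subset x a) ->
  is_ordinal a.
Proof. intros H K. split; auto. intros x y Hx Hy. apply ord_total; auto. Qed.

Lemma ord_succ a : is_ordinal a -> is_ordinal (succ a).
Proof.
  intros Ha. apply ord_intro; intros x Hx; apply in_succ in Hx as [Hx| ->]; auto.
  - eapply ord_mem; eauto.
  - intros y Hy. apply in_succ. left. eapply ord_trans; eauto.
  - intros y Hy. apply in_succ; auto.
Qed.

Lemma ord_bigunion b : (forall x, x ∈ b -> is_ordinal x) -> is_ordinal (bigunion b).
Proof.
  intros H. apply ord_intro; intros x Hx; apply in_bigunion in Hx as [y [Hy Hx]].
  - eapply ord_mem; eauto.
  - intros z Hz. apply in_bigunion. exists y; split; auto. eapply ord_trans; eauto.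
Qed.

Lemma strict_sup_exists b : (forall x, x ∈ b -> is_ordinal x) ->
  exists o, is_strict_sup (fun x => x ∈ b) o.
Proof.
  intros H. set (o := bigunion (upair (bigunion b) b)).
  assert (Ho : forall x, x ∈ o <-> x ∈ bigunion b \/ x ∈ b).
  { intros x. unfold o. rewrite in_bigunion. split.
    - intros [y [Hy Hx]]. apply in_upair in Hy as [->| ->]; auto.
    - intros [Hx|Hx]; eexists; (split; [|exact Hx]); apply in_upair; auto. }
  assert (Hu := ord_bigunion H).
  exists o. split; [|split].
  - apply ord_intro; intros x Hx; apply Ho in Hx as [Hx|Hx].
    + eapply ord_mem; eauto.
    + auto.
    + intros y Hy. apply Ho. left. eapply ord_trans; eauto.
    + intros y Hy. apply Ho. left. apply in_bigunion; eauto.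
  - intros x Hx. apply Ho; auto.
  - intros o' Ho' K x Hx. apply Ho in Hx as [Hx|Hx]; auto.
    apply in_bigunion in Hx as [y [Hy Hx]]. eapply ord_trans; eauto.
Qed.

Lemma ordinals_not_set b : ~ (forall a, is_ordinal a -> a ∈ b).
Proof.
  intros H. set (o := cmp b (fun x => is_ordinal x)).
  assert (Ho : forall x, x ∈ o <-> is_ordinal x).
  { intros x. unfold o. rewrite in_cmp by dfn. split; [tauto|]. auto. }
  apply (@mem_irrefl o). apply Ho. apply ord_intro.
  - intros x; apply Ho.
  - intros x Hx y Hy. apply Ho. apply Ho in Hx. eapply ord_mem; eauto.
Qed.

Lemma image_fun (G : D -> D) a : Fun1 (fun x => x) G G ->
  exists p, is_fun p a /\ forall x, x ∈ a -> fapp p x = G x.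
Proof.
  intros HG. destruct (@def2_replacement D Z (fun x y => y = G x) a) as [b Hb].
  - dfn.
  - intros x _. exists (G x). split; auto.
  - destruct (@bounded_fun D Z a b G HG) as [p [[Hp _] K]].
    + intros x Hx. apply Hb. now exists x.
    + now exists p.
Qed.

(** [F a p] sees the values of [G] below [a] as a set [p]. [G] itself is wanted on the whole model
    and with a definable graph, so that it can occur in further definable predicates. *)
Theorem transfinite_recursion (F : D -> D -> D) : Fun2 (fun x => x) F F ->
  exists G : D -> D, Fun1 (fun x => x) G G /\
    forall a, is_ordinal a ->
      exists p, is_fun p a /\ (forall x, x ∈ a -> fapp p x = G x) /\ G a = F a p.
Proof.
  intros HF.
  set (Rec := fun p a => is_fun p a /\ forall x, x ∈ a ->
    exists q, is_fun q x /\ (forall y, y ∈ x -> fapp q y = fapp p y) /\ fapp p x = F x q).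
  assert (U : forall x p q a b, is_ordinal a -> is_ordinal b -> Rec p a -> Rec q b ->
    x ∈ a -> x ∈ b -> fapp p x = fapp q x).
  { induction x as [x IH] using (well_founded_ind W).
    intros p q a b Ha Hb [Hp Rp] [Hq Rq] Hxa Hxb.
    destruct (Rp x Hxa) as [p' [Fp' [Ep' ->]]]. destruct (Rq x Hxb) as [q' [Fq' [Eq' ->]]].
    f_equal. apply (fun_ext Fp' Fq'). intros y Hy. rewrite Ep', Eq' by auto.
    apply (IH y Hy p q a b); auto; try (split; assumption); eapply ord_trans; eauto. }
  (* The default value [x], taken when there is no approximation, makes [T] total. Then [y = G x] is
     equivalent to [T x y], which is definable although [G] is obtained by [epsilon]. *)
  set (T := fun x y => (exists p, (is_ordinal x /\ Rec p x) /\ y = F x p) \/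
                       (~ (exists p, is_ordinal x /\ Rec p x) /\ y = x)).
  set (G := fun x => the x (T x)).
  assert (TU : forall x y y', T x y -> T x y' -> y = y').
  { intros x y y' [[p [[Ox Rp] ->]]|[N ->]] [[q [[Ox' Rq] ->]]|[N' ->]]; auto.
    - f_equal. apply (@fun_ext D Z p q x); try apply Rp; try apply Rq.
      intros z Hz. apply (U z p q x x); auto.
    - exfalso; apply N'; exists p; auto.
    - exfalso; apply N; exists q; auto. }
  assert (TG : forall x, T x (G x)).
  { intros x. apply (the_spec (P := T x)).
    destruct (classic (exists p, is_ordinal x /\ Rec p x)) as [[p Hp]|N].
    - exists (F x p). left. exists p; auto.
    - exists x. right; auto. }
  assert (GT : forall x y, T x y <-> y = G x).
  { intros x y; split; [intros H; now apply (TU x)|intros ->; auto]. }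
  assert (DG : Fun1 (fun x => x) G G).
  { unfold Fun1. apply dfn_ext with (P := fun s => T (s 1) (s 0)) (P' := fun s => T (s 1) (s 0)).
    - intros s; apply GT.
    - intros s; apply GT.
    - unfold T, Rec. dfn. }
  assert (RG : forall p x, is_ordinal x -> Rec p x -> G x = F x p).
  { intros p x Hx Hp. symmetry. apply GT. left; exists p; auto. }
  assert (RS : forall p a x q, is_ordinal a -> Rec p a -> x ∈ a -> is_fun q x ->
    (forall y, y ∈ x -> fapp q y = fapp p y) -> Rec q x).
  { intros p a x q Ha [Hp Rp] Hx Hq E. split; auto. intros y Hy.
    destruct (Rp y (ord_trans Ha Hx Hy)) as [q' [Fq' [Eq' K]]].
    exists q'. split; auto. split; [|now rewrite E].
    intros z Hz. rewrite Eq' by auto. symmetry. apply E.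
    apply (ord_trans (ord_mem Ha Hx) Hy Hz). }
  assert (RE : forall a, is_ordinal a ->
    exists p, Rec p a /\ forall x, x ∈ a -> fapp p x = G x).
  { induction a as [a IH] using (well_founded_ind W). intros Ha.
    destruct (@image_fun G a DG) as [p [Hp Ep]].
    exists p. split; auto. split; auto. intros x Hx.
    destruct (IH x Hx (ord_mem Ha Hx)) as [q [Rq Eq']].
    exists q. split; [apply Rq|]. split.
    - intros y Hy. rewrite Eq', Ep; auto. eapply ord_trans; eauto.
    - rewrite Ep by auto. apply RG; auto. eapply ord_mem; eauto. }
  exists G. split; auto. intros a Ha. destruct (RE a Ha) as [p [Rp Ep]].
  exists p. split; [apply Rp|]. split; auto.
Qed.

End Ordinals.

(** * Cardinality *)

Section Cardinals.
Context {D : structure} {Z : ZFC D} {W : well_founded (@mem D)}.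
Implicit Types (a b c d f g o p q r x y z : D) (P : D -> Prop).

Definition injective_on a f := forall x y, x ∈ a -> y ∈ a -> fapp f x = fapp f y -> x = y.

Lemma bijection_iff f a b : is_bijection f a b <->
  is_fun_into f a b /\ injective_on a f /\ forall y, y ∈ b -> exists x, x ∈ a /\ fapp f x = y.
Proof.
  split.
  - intros [Hf H]. assert (Ff := proj1 Hf). split; [|split]; auto.
    + intros x y Hx Hy E. destruct (H (fapp f x) (fun_into_fapp Hf Hx)) as [u [_ U]].
      rewrite <- (U x), <- (U y); auto; now apply (app_fun _ _ Ff).
    + intros y Hy. destruct (H y Hy) as [x [Hx _]]. apply (app_fun _ _ Ff) in Hx as [Hx ->].
      now exists x.
  - intros [Hf [I S]]. assert (Ff := proj1 Hf). split; auto. intros y Hy.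
    destruct (S y Hy) as [x [Hx <-]]. exists x. split.
    + now apply (app_fun _ _ Ff).
    + intros x' Hx'. apply (app_fun _ _ Ff) in Hx' as [Hx' E]. apply I; auto.
Qed.

Lemma equinumerous_sym a b : equinumerous a b -> equinumerous b a.
Proof.
  intros [f Hf]. apply bijection_iff in Hf as [Hf [I S]].
  destruct (@bounded_choice D Z b a (fun y x => fapp f x = y)) as [g [Hg E]]; [dfn|auto|].
  exists g. apply bijection_iff. split; [|split]; auto.
  - intros x y Hx Hy K. rewrite <- (E x Hx), <- (E y Hy). now rewrite K.
  - intros x Hx. exists (fapp f x). assert (Hy := fun_into_fapp Hf Hx). split; auto.
    apply I; auto. eapply fun_into_fapp; eauto.
Qed.

Lemma equinumerous_trans a b c : equinumerous a b -> equinumerous b c -> equinumerous a c.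
Proof.
  intros [f Hf] [g Hg]. apply bijection_iff in Hf as [Hf [If Sf]].
  apply bijection_iff in Hg as [Hg [Ig Sg]].
  destruct (@bounded_fun D Z a c (fun x => fapp g (fapp f x))) as [h [Hh E]]; [dfn| |].
  - intros x Hx. apply (fun_into_fapp Hg), (fun_into_fapp Hf Hx).
  - exists h. apply bijection_iff. split; [|split]; auto.
    + intros x y Hx Hy K. rewrite !E in K by auto. apply If, Ig; auto;
        eapply fun_into_fapp; eauto.
    + intros z Hz. destruct (Sg z Hz) as [y [Hy <-]]. destruct (Sf y Hy) as [x [Hx <-]].
      exists x. split; auto.
Qed.

(** At each ordinal pick an element of [x] not yet listed. Were [x] never exhausted, the inverse of
    this enumeration would yield by replacement a set containing all ordinals; so some least ordinal
    exhausts [x]. *)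
Theorem well_ordering x : exists a, is_ordinal a /\ equinumerous a x.
Proof.
  set (Y := cmp (power x) (fun y => exists z, z ∈ y)).
  assert (HY : forall y, y ∈ Y <-> subset y x /\ exists z, z ∈ y).
  { intros y. unfold Y. rewrite in_cmp by dfn. now rewrite in_power. }
  destruct (choice Z (x := Y)) as [c [Fc Hc]].
  { intros y Hy. now apply HY in Hy. }
  assert (Cc : forall y, y ∈ Y -> fapp c y ∈ y).
  { intros y Hy. apply (Hc y); auto. now apply (app_fun _ _ Fc). }
  destruct (@transfinite_recursion D Z W
    (fun a p => fapp c (cmp x (fun v => ~ exists u, u ∈ a /\ v = fapp p u)))) as [G [DG HG]].
  { dfn. }
  set (rest := fun a => cmp x (fun v => ~ exists u, u ∈ a /\ v = G u)).
  assert (Hr : forall a v, v ∈ rest a <-> v ∈ x /\ ~ exists u, u ∈ a /\ v = G u).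
  { intros a v. unfold rest. rewrite in_cmp by dfn. reflexivity. }
  assert (GR : forall a, is_ordinal a -> (exists v, v ∈ rest a) -> G a ∈ rest a).
  { intros a Ha He. destruct (HG a Ha) as [p [_ [Ep ->]]].
    replace (cmp x (fun v => ~ (exists u, u ∈ a /\ v = fapp p u))) with (rest a).
    - apply Cc, HY. split; auto. intros z Hz. now apply Hr in Hz.
    - apply ext. intros v. rewrite Hr, in_cmp by dfn. apply and_iff_compat_l.
      split; intros N [u [Hu E]]; apply N; exists u; split; auto.
      + now rewrite <- Ep.
      + now rewrite Ep. }
  assert (GI : forall a b, is_ordinal a -> is_ordinal b ->
    (exists v, v ∈ rest a) -> (exists v, v ∈ rest b) -> G a = G b -> a = b).
  { assert (K : forall a b, is_ordinal b -> (exists v, v ∈ rest b) -> G a = G b -> ~ a ∈ b).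
    { intros a b Hb He E H. assert (L := GR b Hb He). apply Hr in L as [_ L].
      apply L. now exists a. }
    intros a b Ha Hb Ka Kb E. destruct (ord_total Ha Hb) as [H|[H|H]]; auto; exfalso.
    - exact (K a b Hb Kb E H).
    - exact (K b a Ha Ka (eq_sym E) H). }
  assert (N : exists a, is_ordinal a /\ ~ exists v, v ∈ rest a).
  { apply NNPP. intros N.
    assert (All : forall a, is_ordinal a -> exists v, v ∈ rest a).
    { intros a Ha. apply NNPP; intros K; apply N; now exists a. }
    destruct (@def2_replacement D Z (fun v a => is_ordinal a /\ v = G a)
      (cmp x (fun v => exists a, is_ordinal a /\ v = G a))) as [O HO]; [dfn| |].
    - intros v Hv. rewrite in_cmp in Hv by dfn. destruct Hv as [_ [a [Ha ->]]].
      exists a. split; auto. intros a' [Ha' E]. apply GI; auto.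
    - apply (@ordinals_not_set D Z W O). intros a Ha. apply HO. exists (G a). split; auto.
      rewrite in_cmp by dfn. split; [|now exists a].
      assert (K := GR a Ha (All a Ha)). now apply Hr in K. }
  destruct (least_ordinal N) as [a [Ha [He M]]].
  assert (Ra : forall u, u ∈ a -> exists v, v ∈ rest u).
  { intros u Hu. apply NNPP; intros K.
    apply (ord_subset_not_mem (M u (ord_mem Ha Hu) K)); auto. }
  exists a. split; auto.
  destruct (@bounded_fun D Z a x G DG) as [p [Hp E]].
  { intros u Hu. assert (K := GR u (ord_mem Ha Hu) (Ra u Hu)). now apply Hr in K. }
  exists p. apply bijection_iff. split; [|split]; auto.
  - intros u v Hu Hv K. rewrite !E in K by auto. apply GI; auto; eapply ord_mem; eauto.
  - intros v Hv. apply NNPP; intros K. apply He. exists v. apply Hr. split; auto.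
    intros [u [Hu ->]]. apply K. exists u; auto.
Qed.

(** [C] is the least set that contains [b] minus [a] and is closed under [h]. The bijection is [h]
    on [C] and the identity off [C]. *)
Lemma schroeder_bernstein a b h : subset a b -> is_fun_into h b a -> injective_on b h ->
  equinumerous b a.
Proof.
  intros Hab Hh Ih.
  set (closed := fun z => forall x, x ∈ b ->
    (~ x ∈ a \/ exists y, y ∈ z /\ y ∈ b /\ x = fapp h y) -> x ∈ z).
  set (C := cmp b (fun x => forall z, closed z -> x ∈ z)).
  assert (HC : forall x, x ∈ C <-> x ∈ b /\ forall z, closed z -> x ∈ z).
  { intros x. unfold C. rewrite in_cmp by (unfold closed; dfn). reflexivity. }
  assert (CC : closed C).
  { intros x Hx K. apply HC. split; auto. intros z Hz. apply Hz; auto.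
    destruct K as [K|[y [Hy [Hyb ->]]]]; auto. right. exists y; split; auto.
    apply HC in Hy. now apply Hy. }
  assert (CI : forall x, x ∈ a -> x ∈ C -> exists y, y ∈ C /\ y ∈ b /\ x = fapp h y).
  { intros x Hxa Hx. apply NNPP; intros N.
    (* If [x] were not an image under [h] of an element of [C], then [C] without [x] would still be
       closed. *)
    assert (Hx' : x ∈ cmp C (fun w => w <> x)).
    { apply HC in Hx. apply Hx. intros w Hw K. rewrite in_cmp by dfn. split.
      - apply CC; auto. destruct K as [K|[y [Hy K]]]; auto. right.
        rewrite in_cmp in Hy by dfn. exists y; tauto.
      - intros ->. destruct K as [K|[y [Hy K]]]; auto. apply N.
        rewrite in_cmp in Hy by dfn. exists y; tauto. }
    rewrite in_cmp in Hx' by dfn. tauto. }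
  destruct (@bounded_choice D Z b a
    (fun x y => (x ∈ C /\ y = fapp h x) \/ (~ x ∈ C /\ y = x))) as [f [Hf E]]; [dfn| |].
  { intros x Hx. destruct (classic (x ∈ C)) as [K|K].
    - exists (fapp h x). split; auto. now apply (fun_into_fapp Hh).
    - exists x. split; auto. apply NNPP; intros N. apply K, CC; auto. }
  exists f. apply bijection_iff. split; [|split]; auto.
  - intros x y Hx Hy K.
    destruct (E x Hx) as [[Cx Ex]|[Cx Ex]]; destruct (E y Hy) as [[Cy Ey]|[Cy Ey]];
      rewrite Ex, Ey in K; auto.
    + exfalso; apply Cy. apply CC; auto. right. exists x; auto.
    + exfalso; apply Cx. apply CC; auto. right. exists y; auto.
  - intros y Hy. destruct (classic (y ∈ C)) as [K|K].
    + destruct (CI y Hy K) as [x [Hx [Hxb ->]]]. exists x. split; auto.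
      destruct (E x Hxb) as [[_ Ex]|[Cx _]]; tauto.
    + exists y. split; auto. destruct (E y (Hab y Hy)) as [[Cx _]|[_ Ex]]; tauto.
Qed.

(** Cardinality at most that of [y]. As [q] may take values outside [b], the notion passes to
    subsets of [b] and includes the empty set. *)
Definition covers y b := exists q, is_fun q y /\ forall z, z ∈ b -> exists x, x ∈ y /\ fapp q x = z.

Lemma covers_subset y b c : covers y b -> subset c b -> covers y c.
Proof. intros [q [Hq S]] H. exists q; auto. Qed.

Lemma covers_trans x y z : covers x y -> covers y z -> covers x z.
Proof.
  intros [q [_ Sq]] [r [_ Sr]].
  destruct (@image_fun D Z (fun u => fapp r (fapp q u)) x) as [p [Hp E]]; [dfn|].
  exists p. split; auto. intros w Hw. destruct (Sr w Hw) as [v [Hv <-]].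
  destruct (Sq v Hv) as [u [Hu <-]]. exists u; auto.
Qed.

Lemma equinumerous_covers x y : equinumerous x y -> covers x y.
Proof.
  intros [f Hf]. apply bijection_iff in Hf as [[Hf _] [_ S]]. now exists f.
Qed.

Lemma cantor x : ~ covers x (power x).
Proof.
  intros [q [_ S]].
  destruct (S (cmp x (fun u => ~ u ∈ fapp q u))) as [u [Hu E]].
  - apply in_power. intros u Hu. now rewrite in_cmp in Hu by dfn.
  - assert (K : u ∈ fapp q u <-> ~ u ∈ fapp q u).
    { rewrite E at 1. rewrite in_cmp by dfn. tauto. }
    tauto.
Qed.

Lemma relation_covers y b (Q : D -> D -> Prop) : def2 Q ->
  (forall x z z', Q x z -> Q x z' -> z = z') ->
  (forall z, z ∈ b -> exists x, x ∈ y /\ Q x z) -> covers y b.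
Proof.
  intros HQ U H. destruct (classic (exists z, z ∈ b)) as [[z0 Hz0]|N].
  - destruct (@bounded_choice D Z y b
      (fun x z => Q x z \/ ~ exists z, z ∈ b /\ Q x z)) as [q [[Fq _] E]]; [dfn| |].
    + intros x Hx. destruct (classic (exists z, z ∈ b /\ Q x z)) as [[z Hz]|K].
      * exists z; tauto.
      * exists z0; auto.
    + exists q. split; auto. intros z Hz. destruct (H z Hz) as [x [Hx K]].
      exists x. split; auto. destruct (E x Hx) as [L|L].
      * exact (U x _ _ L K).
      * exfalso; apply L; now exists z.
  - destruct (@image_fun D Z (fun x => x) y) as [p [Hp E]]; [dfn|].
    exists p. split; auto. intros z Hz. exfalso; apply N; now exists z.
Qed.

(** [theta] is the least ordinal not covered by [x], which exists by Cantor's theorem. The last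
    clause is the form in which both bounds on o(kappa) use it. *)
Lemma succ_cardinality x : exists lambda theta,
  is_cardinality_of lambda x /\ is_succ_cardinal theta lambda /\
  forall b, is_ordinal b -> (b ∈ theta <-> covers x b).
Proof.
  destruct (least_ordinal (well_ordering x)) as [lambda [Ol [El Ml]]].
  assert (Cl : is_cardinal lambda).
  { split; auto. intros a Ha E. assert (Oa := ord_mem Ol Ha).
    apply (ord_subset_not_mem (Ml a Oa (equinumerous_trans E El)) Ha). }
  destruct (least_ordinal (P := fun b => ~ covers x b)) as [theta [Ot [Ct Mt]]].
  { destruct (well_ordering (power x)) as [a [Ha E]]. exists a. split; auto.
    intros K. apply (@cantor x). exact (covers_trans K (equinumerous_covers E)). }
  assert (T : forall b, is_ordinal b -> (b ∈ theta <-> covers x b)).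
  { intros b Hb. split.
    - intros H. apply NNPP; intros K. exact (ord_subset_not_mem (Mt b Hb K) H).
    - intros H. apply NNPP; intros K. apply Ct. apply (covers_subset H).
      now apply ord_not_mem. }
  exists lambda, theta. split; [|split]; auto.
  - split; auto. now apply equinumerous_sym.
  - split; [|split].
    + split; auto. intros a Ha E. apply Ct.
      assert (K : covers x a) by (apply T; auto; eapply ord_mem; eauto).
      exact (covers_trans K (equinumerous_covers E)).
    + apply T; auto. now apply equinumerous_covers, equinumerous_sym.
    (* A cardinal above [lambda] but below [theta] would be covered by [lambda]; choosing preimages
       injects it into its own element [lambda]. *)
    + intros o' [Oo Ho] Hl. apply ord_not_mem; auto. intros K.
      apply T in K; auto.
      destruct (covers_trans (equinumerous_covers El) K) as [q [Fq Sq]].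
      destruct (@bounded_choice D Z o' lambda (fun z u => fapp q u = z)) as [h [Hh E]];
        [dfn|auto|].
      apply (Ho lambda Hl). apply equinumerous_sym.
      apply (@schroeder_bernstein lambda o' h); auto.
      * now apply Oo.
      * intros u v Hu Hv L. rewrite <- (E u Hu), <- (E v Hv). now rewrite L.
Qed.

(** * Omega and dependent choice *)

Definition is_limit a := is_ordinal a /\ (exists x, x ∈ a) /\ forall x, x ∈ a -> succ x ∈ a.
Definition is_omega a := is_limit a /\ forall x, x ∈ a -> ~ is_limit x.

(** The ordinals in an inductive set are closed under successor, so their union is a limit ordinal,
    and a minimal limit exists. *)
Lemma omega_exists : exists a, is_omega a.
Proof.
  destruct (infinity Z) as [a [[e [He Ee]] Sa]].
  assert (Sa' : forall x, x ∈ a -> succ x ∈ a).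
  { intros x Hx. destruct (Sa x Hx) as [y [Hy E]]. replace (succ x) with y; auto.
    apply ext. intros z. now rewrite in_succ, E. }
  set (b := cmp a (fun x => is_ordinal x)).
  assert (Hb : forall x, x ∈ b <-> x ∈ a /\ is_ordinal x).
  { intros x. unfold b. rewrite in_cmp by dfn. reflexivity. }
  assert (Sb : forall x, x ∈ b -> succ x ∈ b).
  { intros x Hx. apply Hb in Hx as [Hx Ox]. apply Hb. split; auto. now apply ord_succ. }
  assert (Eb : e ∈ b).
  { apply Hb. split; auto. apply ord_intro; intros x Hx; exfalso; eapply Ee; eauto. }
  assert (L : is_limit (bigunion b)).
  { assert (Ob : forall x, x ∈ b -> is_ordinal x) by (intros x Hx; now apply Hb in Hx).
    split; [now apply ord_bigunion|]. split.
    - exists e. apply in_bigunion. exists (succ e). split; auto. apply in_succ; auto.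
    - intros x Hx. apply in_bigunion in Hx as [y [Hy Hx]]. apply in_bigunion.
      exists (succ y). split; auto. apply in_succ.
      assert (Oy := Ob y Hy). assert (Ox := ord_mem Oy Hx).
      assert (K : subset (succ x) y).
      { intros z Hz. apply in_succ in Hz as [Hz| ->]; auto. eapply ord_trans; eauto. }
      destruct (ord_subset (ord_succ Ox) Oy K); auto. }
  destruct (epsilon_minimal (ex_intro _ _ L)) as [w [Hw M]].
  now exists w.
Qed.

Lemma bigunion_succ a : is_ordinal a -> bigunion (succ a) = a.
Proof.
  intros Ha. apply ext. intros x. rewrite in_bigunion. split.
  - intros [y [Hy Hx]]. apply in_succ in Hy as [Hy| ->]; auto. eapply ord_trans; eauto.
  - intros Hx. exists a. split; auto. apply in_succ; auto.
Qed.

Lemma bigunion_ordinal a : is_ordinal a -> bigunion a ∈ a \/ bigunion a = a.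
Proof.
  intros Ha. destruct (@ord_subset _ _ _ (bigunion a) a); auto.
  - apply ord_bigunion. intros x. apply ord_mem; auto.
  - intros x Hx. apply in_bigunion in Hx as [y [Hy Hx]]. eapply ord_trans; eauto.
Qed.

(** Recursion on n that reads the previous value at the union of n, which is the predecessor if n is
    a successor. If n is its own union, [fapp] returns the empty set there, so the step function
    must be defined at the empty set too. [g0] makes [C] nonempty; the sequence need not start with
    it. *)
Lemma dependent_choice w g0 C (R : D -> D -> Prop) : def2 R -> is_limit w -> g0 ∈ C ->
  (forall g, g ∈ C -> exists g', g' ∈ C /\ R g g') ->
  exists F, is_fun_into F w C /\ forall n, n ∈ w -> R (fapp F n) (fapp F (succ n)).
Proof.
  intros HR [Ow [_ Sw]] Hg0 HC.
  set (e := cmp C (fun x => x <> x)).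
  assert (He : forall z, ~ z ∈ e).
  { intros z Hz. unfold e in Hz. rewrite in_cmp in Hz by dfn. tauto. }
  destruct (@bounded_choice D Z (bigunion (upair C (upair e e))) C
    (fun g g' => g ∈ C -> R g g')) as [s [Hs Es]]; [dfn| |].
  { intros g _. destruct (classic (g ∈ C)) as [H|H].
    - destruct (HC g H) as [g' K]. exists g'; tauto.
    - exists g0; tauto. }
  assert (SC : forall g, g ∈ C \/ g = e -> fapp s g ∈ C).
  { intros g Hg. apply (fun_into_fapp Hs). apply in_bigunion. destruct Hg as [Hg| ->].
    - exists C. split; auto. apply in_upair; auto.
    - exists (upair e e). split; apply in_upair; auto. }
  destruct (@transfinite_recursion D Z W (fun n p => fapp s (fapp p (bigunion n))))
    as [G [DG HG]]; [dfn|].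
  assert (GC : forall n, is_ordinal n -> G n ∈ C).
  { induction n as [n IH] using (well_founded_ind W). intros Hn.
    destruct (HG n Hn) as [p [Fp [Ep ->]]]. apply SC.
    destruct (bigunion_ordinal Hn) as [K|K].
    - left. rewrite Ep by auto. apply IH; auto. eapply ord_mem; eauto.
    - right. rewrite K. apply ext. intros z. split; intros Hz; exfalso.
      + eapply (fapp_out Fp); eauto. apply mem_irrefl.
      + eapply He; eauto. }
  assert (GS : forall n, is_ordinal n -> G (succ n) = fapp s (G n)).
  { intros n Hn. destruct (HG (succ n) (ord_succ Hn)) as [p [Fp [Ep ->]]].
    rewrite bigunion_succ, Ep; auto. apply in_succ; auto. }
  destruct (@bounded_fun D Z w C G DG) as [F [HF EF]].
  { intros n Hn. apply GC. eapply ord_mem; eauto. }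
  exists F. split; auto. intros n Hn. assert (On := ord_mem Ow Hn).
  rewrite !EF by auto. rewrite GS by auto. assert (K := GC n On). apply Es; auto.
  apply in_bigunion. exists C. split; auto. apply in_upair; auto.
Qed.

End Cardinals.

(** * Normal measures and their ultrapowers *)

Section NormalMeasures.
Context {D : structure} {Z : ZFC D} {W : well_founded (@mem D)}.
Implicit Types (a b c d f g h o p q r x y z A X kappa mu : D) (P Q : D -> Prop).

Section OneMeasure.
Variables kappa mu : D.
Hypothesis Hmu : normal_measure kappa mu.
Notation ae := (measure_one kappa mu).

Lemma kappa_ord : is_ordinal kappa.
Proof. apply Hmu. Qed.

Lemma measure_one_cmp P : def1 P -> (ae P <-> cmp kappa P ∈ mu).
Proof.
  intros HP. split.
  - intros [S [HS E]]. replace (cmp kappa P) with S; auto.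
    apply ext. intros z. now rewrite E, in_cmp.
  - intros H. exists (cmp kappa P). split; auto. intros z. now rewrite in_cmp.
Qed.

Lemma ae_mono P Q : def1 Q -> ae P -> (forall x, x ∈ kappa -> P x -> Q x) -> ae Q.
Proof.
  intros HQ [S [HS E]] H. apply measure_one_cmp; auto.
  destruct Hmu as [_ [[_ [_ [Up _]]] _]]. apply (Up S); auto.
  - intros x Hx. apply E in Hx as [Hx K]. rewrite in_cmp; auto.
  - intros x Hx. rewrite in_cmp in Hx; tauto.
Qed.

Lemma ae_and P Q : ae P -> ae Q -> ae (fun x => P x /\ Q x).
Proof.
  intros [S [HS ES]] [T [HT ET]]. exists (inter S T). split.
  - destruct Hmu as [_ [[_ [_ [_ [In _]]]] _]]. apply (In S T); auto.
    intros x. apply in_inter.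
  - intros x. rewrite in_inter, ES, ET. tauto.
Qed.

Lemma ae_mono2 P P' Q : def1 Q -> ae P -> ae P' ->
  (forall x, x ∈ kappa -> P x -> P' x -> Q x) -> ae Q.
Proof.
  intros HQ H H' K. apply (ae_mono HQ (ae_and H H')). intros x Hx [L L']; auto.
Qed.

Lemma ae_exists P : ae P -> exists x, x ∈ kappa /\ P x.
Proof.
  intros [S [HS E]]. apply NNPP; intros N.
  destruct Hmu as [_ [[_ [Hk [_ [_ Ul]]]] _]].
  assert (K := Ul kappa S (fun z H => H)). apply K; auto.
  intros z. rewrite E. split; [|tauto]. intros L. exfalso; apply N. now exists z.
Qed.

Lemma ae_intro P : (forall x, x ∈ kappa -> P x) -> ae P.
Proof.
  intros H. exists kappa. split; [apply Hmu|]. intros x; split; [auto|tauto].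
Qed.

Lemma ae_not P : def1 P -> ~ ae P -> ae (fun x => ~ P x).
Proof.
  intros HP N. destruct Hmu as [_ [[_ [_ [_ [_ Ul]]]] _]].
  apply NNPP; intros K.
  assert (DN : def1 (fun x => ~ P x)) by dfn.
  rewrite measure_one_cmp in N, K by assumption.
  apply N. apply (Ul (cmp kappa P) (cmp kappa (fun x => ~ P x))); auto.
  - intros x Hx. rewrite in_cmp in Hx; tauto.
  - intros x. rewrite !in_cmp by assumption. tauto.
Qed.

Lemma ae_complete c (P : D -> D -> Prop) : def2 P -> c ∈ kappa ->
  (forall u, u ∈ c -> ae (P u)) -> ae (fun x => forall u, u ∈ c -> P u x).
Proof.
  intros HP Hc H.
  assert (HP1 : forall u, def1 (P u)) by dfn.
  destruct (@bounded_fun D Z c mu (fun u => cmp kappa (fun x => P u x))) as [f [Hf E]].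
  - dfn.
  - intros u Hu. change (cmp kappa (P u) ∈ mu). apply measure_one_cmp; auto.
  - destruct Hmu as [_ [_ [_ [Hcomp _]]]].
    apply (ae_mono (P := fun x => forall u v, u ∈ c -> app f u v -> x ∈ v)).
    + dfn.
    + exact (Hcomp c f Hc Hf).
    + intros x Hx K u Hu.
      assert (L : x ∈ cmp kappa (P u)).
      { apply (K u); auto. apply (app_fun _ _ (proj1 Hf)). split; auto. symmetry; now apply E. }
      rewrite in_cmp in L by auto. tauto.
Qed.

Lemma ae_diagonal (P : D -> D -> Prop) : def2 P ->
  (forall u, u ∈ kappa -> ae (P u)) -> ae (fun x => forall u, u ∈ x -> P u x).
Proof.
  intros HP H.
  assert (HP1 : forall u, def1 (P u)) by dfn.
  destruct (@bounded_fun D Z kappa mu (fun u => cmp kappa (fun x => P u x))) as [f [Hf E]].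
  - dfn.
  - intros u Hu. change (cmp kappa (P u) ∈ mu). apply measure_one_cmp; auto.
  - destruct Hmu as [Ok [_ [_ [_ Hnorm]]]].
    apply (ae_mono (P := fun x => forall u v, u ∈ x -> app f u v -> x ∈ v)).
    + dfn.
    + exact (Hnorm f Hf).
    + intros x Hx K u Hu. assert (Hu' := ord_trans Ok Hx Hu).
      assert (L : x ∈ cmp kappa (P u)).
      { apply (K u); auto. apply (app_fun _ _ (proj1 Hf)). split; auto. symmetry; now apply E. }
      rewrite in_cmp in L by auto. tauto.
Qed.

Lemma ae_neq u : ae (fun x => x <> u).
Proof.
  destruct (classic (u ∈ kappa)) as [Hu|Hu].
  - apply ae_not; [dfn|]. intros H. rewrite measure_one_cmp in H by dfn.
    destruct Hmu as [_ [_ [Np _]]]. apply (Np u _ Hu) in H; auto.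
    intros x. rewrite in_cmp by dfn. split; [tauto|]. intros [->| ->]; auto.
  - apply ae_intro. intros x Hx ->; auto.
Qed.

(** Single points are null, and completeness discards all those below [u] at once. *)
Lemma ae_above u : u ∈ kappa -> ae (fun x => u ∈ x).
Proof.
  intros Hu. assert (Ok := kappa_ord).
  assert (K : ae (fun x => forall v, v ∈ u -> x <> v)).
  { apply ae_complete; auto; [dfn|]. intros v _. apply ae_neq. }
  apply (ae_mono2 (P := fun x => forall v, v ∈ u -> x <> v) (P' := fun x => x <> u)); auto.
  - dfn.
  - apply ae_neq.
  - intros x Hx L N. destruct (ord_total (ord_mem Ok Hx) (ord_mem Ok Hu)) as [H|[H|H]]; auto.
    + now destruct (L x H).
    + now destruct (N H).
Qed.

(** Otherwise each set {x : g x <> u} has measure one, and on their diagonal intersection no value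
    below x is left for g x. *)
Lemma fodor (g : D -> D) : Fun1 (fun x => x) g g -> ae (fun x => g x ∈ x) ->
  exists u, u ∈ kappa /\ ae (fun x => g x = u).
Proof.
  intros Hg H. apply NNPP; intros N.
  assert (K : ae (fun x => forall u, u ∈ x -> g x <> u)).
  { apply ae_diagonal; [dfn|]. intros u Hu. apply ae_not; [dfn|].
    intros L. apply N. now exists u. }
  destruct (ae_exists (ae_and H K)) as [x [_ [L L']]]. exact (L' _ L eq_refl).
Qed.

(** Uncountability comes from normality: the diagonal intersection of the sets {x : x <> succ u} has
    measure one, so it contains a nonzero x, and such an x is a limit. If kappa were at most omega,
    x would be a limit below omega. *)
Lemma omega_mem w : is_omega w -> w ∈ kappa.
Proof.
  intros [Lw Mw]. assert (Ok := kappa_ord). apply NNPP; intros N.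
  assert (Sk : subset kappa w) by (apply ord_not_mem; auto; apply Lw).
  assert (K : ae (fun x => forall u, u ∈ x -> x <> succ u)).
  { apply ae_diagonal; [dfn|]. intros u Hu. apply ae_neq. }
  assert (E : exists u0, u0 ∈ kappa).
  { destruct (ae_exists K) as [u [Hu _]]. now exists u. }
  destruct (least_ordinal (P := fun u => u ∈ kappa)) as [u0 [Ou0 [Hu0 M]]].
  { destruct E as [u Hu]. exists u. split; auto. eapply ord_mem; eauto. }
  destruct (ae_exists (ae_and K (ae_above Hu0))) as [x [Hx [Kx Lx]]].
  apply (Mw x (Sk x Hx)). assert (Ox := ord_mem Ok Hx).
  split; auto. split; [now exists u0|]. intros v Hv.
  assert (Ov := ord_mem Ox Hv).
  assert (T : subset (succ v) x).
  { intros z Hz. apply in_succ in Hz as [Hz| ->]; auto. eapply ord_trans; eauto. }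
  destruct (ord_subset (ord_succ Ov) Ox T) as [E'|E']; auto.
  exfalso. exact (Kx v Hv (eq_sym E')).
Qed.

(** [A] consists of the u that lie in a x for almost all x. For each u membership in a x is decided
    almost everywhere, and a diagonal intersection settles all u ∈ x simultaneously. *)
Lemma ae_restriction (a : D -> D) : Fun1 (fun x => x) a a -> ae (fun x => subset (a x) x) ->
  exists A, subset A kappa /\ ae (fun x => a x = inter A x).
Proof.
  intros Ha H.
  set (A := cmp kappa (fun u => ae (fun x => u ∈ a x))).
  assert (HA : forall u, u ∈ A <-> u ∈ kappa /\ ae (fun x => u ∈ a x)).
  { intros u. unfold A. rewrite in_cmp by dfn. reflexivity. }
  exists A. split; [intros u Hu; now apply HA in Hu|].
  assert (K : ae (fun x => forall u, u ∈ x -> (u ∈ a x <-> u ∈ A))).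
  { apply ae_diagonal; [dfn|]. intros u Hu. destruct (classic (u ∈ A)) as [L|L].
    - assert (L' := L). apply HA in L' as [_ L'].
      apply (ae_mono (P := fun x => u ∈ a x)); auto; [dfn|tauto].
    - assert (L' : ae (fun x => ~ u ∈ a x)).
      { apply ae_not; [dfn|]. intros K; apply L, HA; auto. }
      apply (ae_mono (P := fun x => ~ u ∈ a x)); auto; [dfn|tauto]. }
  apply (ae_mono2 (P := fun x => subset (a x) x)
    (P' := fun x => forall u, u ∈ x -> (u ∈ a x <-> u ∈ A))); auto.
  - dfn.
  - intros x Hx L1 L2. apply ext. intros u. rewrite in_inter. split.
    + intros Hu. split; auto. apply L2; auto.
    + intros [Hu Hux]. apply L2; auto.
Qed.

Lemma inter_inj A B : subset A kappa -> subset B kappa ->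
  ae (fun x => inter A x = inter B x) -> A = B.
Proof.
  assert (K : forall A B, subset A kappa -> ae (fun x => inter A x = inter B x) -> subset A B).
  { clear A B. intros A B HA H u Hu.
    destruct (ae_exists (ae_and H (ae_above (HA u Hu)))) as [x [Hx [E L]]].
    assert (M : u ∈ inter A x) by (apply in_inter; auto).
    rewrite E in M. now apply in_inter in M. }
  intros HA HB H. apply subset_antisym; apply K; auto.
  apply (ae_mono (P := fun x => inter A x = inter B x)); auto. dfn.
Qed.

Lemma ae_choice b (Q : D -> D -> Prop) : def2 Q -> ae (fun x => exists y, y ∈ b /\ Q x y) ->
  exists f, is_fun_into f kappa b /\ ae (fun x => Q x (fapp f x)).
Proof.
  intros HQ H. destruct (ae_exists H) as [x0 [_ [y0 [Hy0 _]]]].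
  destruct (@bounded_choice D Z kappa b (fun x y => Q x y \/ ~ exists y, y ∈ b /\ Q x y))
    as [f [Hf E]]; [dfn| |].
  - intros x Hx. destruct (classic (exists y, y ∈ b /\ Q x y)) as [[y Hy]|N].
    + exists y; tauto.
    + exists y0; auto.
  - exists f. split; auto. apply (ae_mono (P := fun x => exists y, y ∈ b /\ Q x y)); auto.
    + dfn.
    + intros x Hx K. destruct (E x Hx); tauto.
Qed.

(** An ordinal u < kappa is thus represented both by a constant function and by x |-> u ∩ x, so that
    elements and subsets of kappa share one form. *)
Lemma ae_const u : u ∈ kappa -> ae (fun x => inter u x = u).
Proof.
  intros Hu. apply (ae_mono (P := fun x => u ∈ x)); [dfn|now apply ae_above|].
  intros x Hx H. apply ext. intros v. rewrite in_inter. split; [tauto|].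
  intros Hv. split; auto. apply (ord_trans (ord_mem kappa_ord Hx) H Hv).
Qed.

Lemma ord_subset_kappa u : u ∈ kappa -> subset u kappa.
Proof. apply kappa_ord. Qed.

(** Since B ∩ x is contained in x, [g] is regressive, hence constant almost everywhere. *)
Lemma ae_mem_inter (g : D -> D) B : Fun1 (fun x => x) g g ->
  ae (fun x => g x ∈ inter B x) -> exists u, u ∈ B /\ u ∈ kappa /\ ae (fun x => g x = inter u x).
Proof.
  intros Hg H. destruct (@fodor g Hg) as [u [Hu K]].
  - apply (ae_mono (P := fun x => g x ∈ inter B x)); auto; [dfn|].
    intros x _ L. now apply in_inter in L.
  - exists u. destruct (ae_exists (ae_and H K)) as [x [_ [L <-]]].
    apply in_inter in L as [L _]. split; auto. split; auto.
    apply (ae_mono2 (P := fun y => g y = g x) (P' := fun y => inter (g x) y = g x));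
      auto; [dfn|now apply ae_const|].
    intros y _ -> ->; auto.
Qed.

Lemma ae_inter_mem u B : u ∈ B -> subset B kappa -> ae (fun x => inter u x ∈ inter B x).
Proof.
  intros Hu HB. apply (ae_mono2 (P := fun x => u ∈ x) (P' := fun x => inter u x = u)).
  - dfn.
  - apply ae_above; auto.
  - apply ae_const; auto.
  - intros x _ H ->. now apply in_inter.
Qed.

Lemma ult_mem_iff f g : is_fun f kappa -> is_fun g kappa ->
  (ult_mem kappa mu f g <-> ae (fun x => fapp f x ∈ fapp g x)).
Proof.
  intros Hf Hg. split; intros H; (eapply ae_mono; [dfn|exact H|]).
  - intros x Hx [y [z [Hy [Hz K]]]]. apply (app_fun _ _ Hf) in Hy as [_ ->].
    now apply (app_fun _ _ Hg) in Hz as [_ ->].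
  - intros x Hx K. exists (fapp f x), (fapp g x). rewrite (app_fun _ _ Hf), (app_fun _ _ Hg). auto.
Qed.

Lemma ult_eq_iff f g : is_fun f kappa -> is_fun g kappa ->
  (ult_eq kappa mu f g <-> ae (fun x => fapp f x = fapp g x)).
Proof.
  intros Hf Hg. split; intros H; (eapply ae_mono; [dfn|exact H|]).
  - intros x Hx [y [Hy Hz]]. apply (app_fun _ _ Hf) in Hy as [_ ->].
    now apply (app_fun _ _ Hg) in Hz as [_ ->].
  - intros x Hx K. exists (fapp f x). rewrite (app_fun _ _ Hf), (app_fun _ _ Hg). auto.
Qed.

Lemma inter_fun A : subset A kappa ->
  exists f, is_fun_into f kappa (power kappa) /\ forall x, x ∈ kappa -> fapp f x = inter A x.
Proof.
  intros HA. apply bounded_fun; [dfn|]. intros x _. apply in_power.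
  intros u Hu. apply in_inter in Hu as [Hu _]; auto.
Qed.

(* Every element of the ultrapower that is a family of subsets of kappa is
   [alpha |-> h alpha] for some h with h alpha a family of subsets of alpha, and
   a subset A of kappa is [alpha |-> A ∩ alpha]. *)
Definition represents X h :=
  is_fun h kappa /\ (forall x, x ∈ kappa -> subset (fapp h x) (power x)) /\
  forall A, subset A kappa -> (A ∈ X <-> ae (fun x => inter A x ∈ fapp h x)).

Section Represented.
Variables X h : D.
Hypothesis HX : forall A, A ∈ X -> subset A kappa.
Hypothesis Hh : represents X h.

(** [h] may agree almost everywhere with some x |-> B ∩ x; this makes the two values that the
    collapse could give it coincide. *)
Lemma represents_subset B : subset B kappa -> ae (fun x => fapp h x = inter B x) -> X = B.
Proof.
  destruct Hh as [_ [_ R]]. intros HB H. apply ext. intros A. split.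
  - intros HA. assert (K := HX HA). apply R in HA; auto.
    destruct (@ae_mem_inter (fun x => inter A x) B) as [u [Hu [Hk L]]]; [dfn| |].
    + apply (ae_mono2 (P := fun x => inter A x ∈ fapp h x)
        (P' := fun x => fapp h x = inter B x)); auto.
      * dfn.
      * intros x _ L1 L2. now rewrite <- L2.
    + replace A with u; auto. symmetry; apply inter_inj; auto. now apply ord_subset_kappa.
  - intros HA. assert (K := ord_subset_kappa (HB A HA)). apply R; auto.
    apply (ae_mono2 (P := fun x => inter A x ∈ inter B x)
      (P' := fun x => fapp h x = inter B x)); auto.
    + dfn.
    + now apply ae_inter_mem.
    + intros x _ L1 ->; auto.
Qed.

(** An explicit approximation to the collapse: its domain consists of [h] and all functions x |-> A
    ∩ x, sent to [X] and to A. Predecessors of [h] are again of the second kind by [ae_restriction],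
    and those of x |-> A ∩ x by Fodor's argument. *)
Lemma represents_in_Ult : in_Ult kappa mu X.
Proof.
  destruct (Hh) as [Fh [Ph R]].
  set (d := cmp (bigunion (upair (power (cart kappa (power kappa))) (upair h h)))
    (fun f => f = h \/ (is_fun f kappa /\ exists A, subset A kappa /\
       forall x, x ∈ kappa -> fapp f x = inter A x))).
  assert (Hd : forall f, f ∈ d <-> f = h \/ (is_fun f kappa /\ exists A, subset A kappa /\
       forall x, x ∈ kappa -> fapp f x = inter A x)).
  { intros f. unfold d. rewrite in_cmp by dfn. split; [tauto|]. intros K; split; auto.
    apply in_bigunion. destruct K as [->|[Ff [A [HA E]]]].
    - exists (upair h h). split; apply in_upair; auto.
    - exists (power (cart kappa (power kappa))). split; [apply in_upair; auto|].
      apply fun_in_power_cart. apply fun_into_intro; auto.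
      intros x Hx. rewrite E by auto. apply in_power. intros u Hu.
      apply in_inter in Hu as [Hu _]; auto. }
  set (V := fun f y => (subset y kappa /\ ae (fun x => fapp f x = inter y x)) \/ (y = X /\ f = h)).
  assert (VU : forall f y y', V f y -> V f y' -> y = y').
  { intros f y y' [[H1 H2]|[-> ->]] [[K1 K2]|[-> K]]; auto.
    - apply inter_inj; auto.
      apply (ae_mono2 (P := fun x => fapp f x = inter y x)
        (P' := fun x => fapp f x = inter y' x)); auto.
      + dfn.
      + intros x _ <- <-; auto.
    - subst f. symmetry. now apply represents_subset.
    - now apply represents_subset. }
  destruct (@bounded_choice D Z d (bigunion (upair (power kappa) (upair X X))) V) as [c [[Fc _] Ec]].
  { unfold V; dfn. }
  { intros f Hf. apply Hd in Hf as [->|[Ff [A [HA E]]]].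
    - exists X. split; [|right; auto]. apply in_bigunion. exists (upair X X).
      split; apply in_upair; auto.
    - exists A. split.
      + apply in_bigunion. exists (power kappa). split; [apply in_upair|apply in_power]; auto.
      + left. split; auto. now apply ae_intro. }
  assert (CV : forall f y, app c f y <-> f ∈ d /\ V f y).
  { intros f y. rewrite (app_fun _ _ Fc). split.
    - intros [Hf ->]. split; auto.
    - intros [Hf K]. split; auto. apply (VU f); auto. }
  assert (Fd : forall f, f ∈ d -> is_fun f kappa).
  { intros f Hf. apply Hd in Hf as [->|[Ff _]]; auto. }
  assert (Rd : forall A, subset A kappa -> exists f, f ∈ d /\ V f A /\
    forall x, x ∈ kappa -> fapp f x = inter A x).
  { intros A HA. destruct (inter_fun HA) as [f [[Ff _] E]]. exists f. split; [|split]; auto.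
    - apply Hd. right. split; auto. now exists A.
    - left. split; auto. now apply ae_intro. }
  exists c, d, h. split; [split; [|split; [|split]]|split]; auto.
  - intros f g Hf Hg Hm. apply (ult_mem_iff Hg (Fd f Hf)) in Hm.
    assert (K : exists B, subset B kappa /\ ae (fun x => fapp g x = inter B x)).
    { apply Hd in Hf as [->|[Ff [A [HA E]]]].
      - apply ae_restriction; [dfn|].
        apply (ae_mono (P := fun x => fapp g x ∈ fapp h x)); auto; [dfn|].
        intros x Hx K. apply in_power. now apply (Ph x Hx).
      - destruct (@ae_mem_inter (fapp g) A) as [u [Hu [Hk L]]]; [dfn| |].
        + apply (ae_mono (P := fun x => fapp g x ∈ fapp f x)); auto; [dfn|].
          intros x Hx K. now rewrite <- E.
        + exists u. split; auto. now apply ord_subset_kappa. }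
    destruct K as [B [HB K]]. destruct (Rd B HB) as [g' [Hg' [_ E]]]. exists g'. split; auto.
    apply (ult_eq_iff (Fd _ Hg') Hg).
    apply (ae_mono (P := fun x => fapp g x = inter B x)); auto; [dfn|].
    intros x Hx ->. auto.
  - intros f y Hf Hfy z. apply CV in Hfy as [_ Vf].
    destruct Vf as [[Hy Ey]|[-> ->]]; split.
    + intros Hz. destruct (Rd z (ord_subset_kappa (Hy z Hz))) as [g [Hg [Vg E]]].
      exists g. split; auto. split; [|now apply CV].
      apply (ult_mem_iff (Fd _ Hg) (Fd _ Hf)).
      apply (ae_mono2 (P := fun x => fapp f x = inter y x) (P' := fun x => inter z x ∈ inter y x));
        auto; [dfn|now apply ae_inter_mem|].
      intros x Hx -> K. now rewrite E.
    + intros [g [Hg [Hm Hgz]]]. apply (ult_mem_iff (Fd _ Hg) (Fd _ Hf)) in Hm.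
      assert (M : ae (fun x => fapp g x ∈ inter y x)).
      { apply (ae_mono2 (P := fun x => fapp g x ∈ fapp f x) (P' := fun x => fapp f x = inter y x));
          auto; [dfn|]. intros x _ K <-; auto. }
      destruct (@ae_mem_inter (fapp g) y) as [u [Hu [Hk L]]]; [dfn|auto|].
      replace z with u; auto.
      apply CV in Hgz as [_ Vg]. apply (VU g); auto. left. split; auto. now apply ord_subset_kappa.
    + intros Hz. destruct (Rd z (HX Hz)) as [g [Hg [Vg E]]].
      exists g. split; auto. split; [|now apply CV].
      apply (ult_mem_iff (Fd _ Hg) Fh). apply R in Hz; auto.
      apply (ae_mono (P := fun x => inter z x ∈ fapp h x)); auto; [dfn|].
      intros x Hx. now rewrite E.
    + intros [g [Hg [Hm Hgz]]]. apply (ult_mem_iff (Fd _ Hg) Fh) in Hm.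
      apply CV in Hgz as [_ [[Hz Ez]|[-> ->]]].
      * apply R; auto.
        apply (ae_mono2 (P := fun x => fapp g x ∈ fapp h x) (P' := fun x => fapp g x = inter z x));
          auto; [dfn|]. intros x _ K <-; auto.
      * exfalso. destruct (ae_exists Hm) as [x [_ K]]. exact (mem_irrefl K).
  - apply Hd; auto.
  - apply CV. split; [apply Hd; auto|right; auto].
Qed.

End Represented.

Lemma fapp_bound f x z : z ∈ fapp f x -> z ∈ bigunion (bigunion (bigunion f)).
Proof.
  intros H. apply in_fapp in H as [v [Hv Hz]]. apply in_bigunion. exists v; split; auto.
  apply in_bigunion. exists (upair x v); split; [|apply in_upair; auto].
  apply in_bigunion. exists (pair x v). split; [now apply app_pair|].
  rewrite pair_eq. apply in_upair; auto.
Qed.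

(** A function of the approximation that collapses to an element u of kappa is u almost everywhere;
    one that collapses to a subset A of kappa is A ∩ x almost everywhere. This tells which A belong
    to the collapse of [f]. *)
Lemma in_Ult_represents X : in_Ult kappa mu X -> (forall A, A ∈ X -> subset A kappa) ->
  exists h, represents X h.
Proof.
  intros [c [d [f [[Fc [Fd [Pd Cd]]] [Hf Hfx]]]]] HX.
  assert (pull : forall e y g, e ∈ d -> app c e y -> is_fun g kappa ->
    ae (fun x => fapp g x ∈ fapp e x) ->
    exists g' u, g' ∈ d /\ app c g' u /\ u ∈ y /\ ae (fun x => fapp g x = fapp g' x)).
  { intros e y g He Hey Fg Hm. destruct (Pd e g He Fg) as [g' [Hg' E]].
    { now apply (ult_mem_iff Fg (Fd e He)). }
    apply (ult_eq_iff (Fd g' Hg') Fg) in E.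
    destruct (proj2 Fc g' Hg') as [u [Hu _]].
    exists g', u. split; auto. split; auto. split.
    - apply (Cd e y He Hey). exists g'. split; auto. split; auto.
      apply (ult_mem_iff (Fd g' Hg') (Fd e He)).
      apply (ae_mono2 (P := fun x => fapp g x ∈ fapp e x) (P' := fun x => fapp g' x = fapp g x));
        auto; [dfn|]. intros x _ K ->; auto.
    - apply (ae_mono (P := fun x => fapp g' x = fapp g x)); auto. dfn. }
  (* Łoś for a bounded quantifier: counterexamples chosen almost everywhere form a predecessor of
     [e], which has a representative in [d] with collapse in [y], where [Q] holds. *)
  assert (bounded : forall e y (Q : D -> D -> Prop), e ∈ d -> app c e y -> def2 Q ->
    (forall u g', u ∈ y -> g' ∈ d -> app c g' u -> ae (fun x => Q x (fapp g' x))) ->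
    ae (fun x => forall v, v ∈ fapp e x -> Q x v)).
  { intros e y Q He Hey HQ H. apply NNPP; intros N. apply ae_not in N; [|dfn].
    destruct (@ae_choice (bigunion (bigunion (bigunion e))) (fun x v => v ∈ fapp e x /\ ~ Q x v))
      as [g [[Fg _] Hg]]; [dfn| |].
    { apply (ae_mono (P := fun x => ~ forall v, v ∈ fapp e x -> Q x v)); auto; [dfn|].
      intros x _ K. apply not_all_ex_not in K as [v K]. apply imply_to_and in K as [K1 K2].
      exists v. split; auto. now apply (@fapp_bound e x). }
    destruct (pull e y g He Hey Fg) as [g' [u [Hg' [Hgu [Hu E]]]]].
    { apply (ae_mono (P := fun x => fapp g x ∈ fapp e x /\ ~ Q x (fapp g x))); auto; [dfn|tauto]. }
    destruct (ae_exists (ae_and (ae_and Hg E) (H u g' Hu Hg' Hgu))) as [x [_ [[[_ K1] K2] K3]]].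
    rewrite <- K2 in K3. tauto. }
  assert (S1 : forall u e, u ∈ kappa -> e ∈ d -> app c e u -> ae (fun x => fapp e x = u)).
  { induction u as [u IH] using (well_founded_ind W). intros e Hu He Heu.
    assert (K1 : ae (fun x => forall v, v ∈ u -> v ∈ fapp e x)).
    { apply ae_complete; auto; [dfn|]. intros v Hv.
      assert (Hv' := Hv). apply (Cd e u He Heu) in Hv' as [g [Hg [Hm Hgv]]].
      apply (ult_mem_iff (Fd g Hg) (Fd e He)) in Hm.
      assert (K := IH v Hv g (ord_subset_kappa Hu Hv) Hg Hgv).
      apply (ae_mono2 (P := fun x => fapp g x ∈ fapp e x) (P' := fun x => fapp g x = v)); auto;
        [dfn|]. intros x _ L <-; auto. }
    assert (K2 : ae (fun x => forall v, v ∈ fapp e x -> v ∈ u)).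
    { apply (bounded e u (fun _ v => v ∈ u)); auto; [dfn|].
      intros v g' Hv Hg' Hgv. assert (K := IH v Hv g' (ord_subset_kappa Hu Hv) Hg' Hgv).
      apply (ae_mono (P := fun x => fapp g' x = v)); auto; [dfn|]. intros x _ ->; auto. }
    apply (ae_mono2 (P := fun x => forall v, v ∈ u -> v ∈ fapp e x)
      (P' := fun x => forall v, v ∈ fapp e x -> v ∈ u)); auto; [dfn|].
    intros x _ L1 L2. apply subset_antisym; auto. }
  assert (S2 : forall A e, subset A kappa -> e ∈ d -> app c e A ->
    ae (fun x => fapp e x = inter A x)).
  { intros A e HA He HeA.
    assert (K1 : ae (fun x => forall v, v ∈ x -> v ∈ A -> v ∈ fapp e x)).
    { apply ae_diagonal; [dfn|]. intros v Hv. destruct (classic (v ∈ A)) as [HvA|HvA].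
      - assert (Hv' := HvA). apply (Cd e A He HeA) in Hv' as [g [Hg [Hm Hgv]]].
        apply (ult_mem_iff (Fd g Hg) (Fd e He)) in Hm.
        assert (K := S1 v g Hv Hg Hgv).
        apply (ae_mono2 (P := fun x => fapp g x ∈ fapp e x) (P' := fun x => fapp g x = v)); auto;
        [dfn|]. intros x _ L <-; auto.
      - apply ae_intro. tauto. }
    assert (K2 : ae (fun x => forall v, v ∈ fapp e x -> v ∈ inter A x)).
    { apply (bounded e A (fun x v => v ∈ inter A x)); auto; [dfn|].
      intros v g' Hv Hg' Hgv. assert (K := S1 v g' (HA v Hv) Hg' Hgv).
      apply (ae_mono2 (P := fun x => fapp g' x = v) (P' := fun x => v ∈ x)); auto;
        [dfn|now apply ae_above; auto|].
      intros x _ -> L; now apply in_inter. }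
    apply (ae_mono2 (P := fun x => forall v, v ∈ x -> v ∈ A -> v ∈ fapp e x)
      (P' := fun x => forall v, v ∈ fapp e x -> v ∈ inter A x)); auto; [dfn|].
    intros x _ L1 L2. apply subset_antisym; auto.
    intros v Hv. apply in_inter in Hv as [? ?]; auto. }
  assert (Main : forall A, subset A kappa -> (A ∈ X <-> ae (fun x => inter A x ∈ fapp f x))).
  { intros A HA. split.
    - intros H. apply (Cd f X Hf Hfx) in H as [g [Hg [Hm HgA]]].
      apply (ult_mem_iff (Fd g Hg) (Fd f Hf)) in Hm.
      apply (ae_mono2 (P := fun x => fapp g x ∈ fapp f x) (P' := fun x => fapp g x = inter A x));
        auto; [dfn|]. intros x _ K <-; auto.
    - intros H. destruct (inter_fun HA) as [a [[Fa _] Ea]].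
      destruct (pull f X a Hf Hfx Fa) as [g [B [Hg [HgB [HB E]]]]].
      { apply (ae_mono (P := fun x => inter A x ∈ fapp f x)); auto; [dfn|].
        intros x Hx K. now rewrite Ea. }
      replace A with B; auto. symmetry. apply inter_inj; auto.
      assert (K := S2 B g (HX B HB) Hg HgB).
      apply (ae_mono2 (P := fun x => fapp a x = fapp g x) (P' := fun x => fapp g x = inter B x));
        auto; [dfn|].
      intros x Hx L1 <-. now rewrite <- Ea. }
  (* The values of [f] may have other elements; cutting them down to subsets of x loses no A ∩ x. *)
  destruct (@bounded_fun D Z kappa (power (power kappa))
    (fun x => cmp (fapp f x) (fun z => subset z x))) as [h [[Fh _] Eh]]; [dfn| |].
  { intros x Hx. apply in_power. intros z Hz. rewrite in_cmp in Hz by dfn.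
    apply in_power. intros v Hv. apply (ord_subset_kappa Hx). now apply Hz. }
  exists h. split; auto. split.
  - intros x Hx z Hz. rewrite Eh, in_cmp in Hz by (auto || dfn). now apply in_power.
  - intros A HA. rewrite Main by auto.
    assert (S : forall x, subset (inter A x) x) by (intros x v Hv; now apply in_inter in Hv).
    split; intros H.
    + apply (ae_mono (P := fun x => inter A x ∈ fapp f x)); auto; [dfn|].
      intros x Hx K. rewrite Eh, in_cmp by (auto || dfn). auto.
    + apply (ae_mono (P := fun x => inter A x ∈ fapp h x)); auto; [dfn|].
      intros x Hx K. rewrite Eh, in_cmp in K by (auto || dfn). tauto.
Qed.

End OneMeasure.
End NormalMeasures.

(** * Well-foundedness of the Mitchell order *)

Section WellFoundedness.
Context {D : structure} {Z : ZFC D} {W : well_founded (@mem D)}.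
Implicit Types (a b c d f g h o p q r x y z A E F mu nu kappa : D).

(* The order [limit_below] below is a variant of the Ketonen order. Its
   well-foundedness needs only the countable intersection property. *)
Definition cip w b x :=
  (exists A, A ∈ x) /\ (forall A, A ∈ x -> subset A b) /\
  forall F, is_fun_into F w x -> exists u, u ∈ b /\ forall n, n ∈ w -> u ∈ fapp F n.

#[local] Instance Rel3_cip j : Rel3 j cip cip.
Proof. unfold cip; dfn. Qed.

(** With [limit_by] this says that every A in [nu] satisfies A ∩ b ∈ h b for [mu]-many b < a: [nu]
    is contained in the limit along [mu] of families h b living on smaller ordinals. *)
Definition trace w h A a := cmp a (fun b => inter A b ∈ fapp h b /\ cip w b (fapp h b)).
Definition limit_by w a nu mu h := forall A, A ∈ nu -> trace w h A a ∈ mu.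
Definition limit_below w a nu mu := exists h, limit_by w a nu mu h.

Lemma in_trace w h A a b :
  b ∈ trace w h A a <-> b ∈ a /\ inter A b ∈ fapp h b /\ cip w b (fapp h b).
Proof. unfold trace. rewrite in_cmp by dfn. reflexivity. Qed.

#[local] Instance Rel4_limit_by w j : Rel4 j (limit_by w) (limit_by (j w)).
Proof. unfold limit_by, trace; dfn. Qed.

Lemma inter_inter A a b : is_ordinal a -> b ∈ a -> inter (inter A a) b = inter A b.
Proof.
  intros Ha Hb. apply ext. intros x. rewrite !in_inter. split; [tauto|].
  intros [H K]. split; auto. split; auto. eapply ord_trans; eauto.
Qed.

(** Whether a point x belongs to the trace depends only on A ∩ x. *)
Lemma trace_inter w h A a b : is_ordinal a -> b ∈ a ->
  trace w h (inter A b) b = inter (trace w h A a) b.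
Proof.
  intros Ha Hb. apply ext. intros x. rewrite in_inter, !in_trace. split.
  - intros [Hx H]. rewrite inter_inter in H; auto; [|eapply ord_mem; eauto].
    split; auto. split; auto. eapply ord_trans; eauto.
  - intros [[_ H] Hx]. split; auto. rewrite inter_inter; auto. eapply ord_mem; eauto.
Qed.

(** Confines the witnesses [h] to a fixed set, as dependent choice requires. *)
Lemma limit_by_function w a nu mu h : is_ordinal a -> limit_by w a nu mu h ->
  exists g, g ∈ power (cart a (power (power a))) /\ limit_by w a nu mu g.
Proof.
  intros Ha H.
  destruct (@bounded_fun D Z a (power (power a))
    (fun b => cmp (power b) (fun A => A ∈ fapp h b /\ cip w b (fapp h b)))) as [g [Hg E]].
  - dfn.
  - intros b Hb. apply in_power. intros A HA. rewrite in_cmp, in_power in HA by dfn.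
    apply in_power. intros x Hx. eapply ord_trans; eauto. now apply HA.
  - exists g. split; [now apply fun_in_power_cart|]. intros A HA.
    replace (trace w g A a) with (trace w h A a); auto.
    assert (E1 : forall b, b ∈ a -> cip w b (fapp h b) -> fapp g b = fapp h b).
    { intros b Hb K. rewrite E by auto. apply ext. intros B. rewrite in_cmp, in_power by dfn.
      split; [tauto|]. intros HB. split; auto. now apply K. }
    apply ext. intros b. rewrite !in_trace. split.
    + intros [Hb [H1 H2]]. now rewrite E1.
    + intros [Hb [H1 H2]]. assert (H1' := H1). rewrite E, in_cmp in H1' by (auto || dfn).
      rewrite E1 in H1, H2 by tauto. tauto.
Qed.

(* Limits compose; the point is that the composite g' lies below g at every
   single b, so that a descent among families on a induces descents at b < a. *)
Lemma limit_step w a nu nu' mu0 g : is_limit w -> is_ordinal a ->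
  limit_by w a nu mu0 g -> limit_below w a nu' nu ->
  exists g', g' ∈ power (cart a (power (power a))) /\ limit_by w a nu' mu0 g' /\
    forall b, b ∈ a -> (exists A, A ∈ fapp g' b) ->
      cip w b (fapp g' b) /\ limit_below w b (fapp g' b) (fapp g b).
Proof.
  intros [_ [[n0 Hn0] _]] Ha Hg [h Hh].
  (* [g' b] is the limit of the families [h u], u < b, along [g b]: a set belongs to it when its
     trace under [h] belongs to [g b]. *)
  destruct (@bounded_fun D Z a (power (power a))
    (fun b => cmp (power b) (fun A => trace w h A b ∈ fapp g b /\ cip w b (fapp g b))))
    as [g' [Hg' E]].
  - unfold trace. dfn.
  - intros b Hb. apply in_power. intros A HA. unfold trace in HA.
    rewrite in_cmp, in_power in HA by dfn.
    apply in_power. intros x Hx. eapply ord_trans; eauto. now apply HA.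
  - assert (HE : forall b A, b ∈ a -> (A ∈ fapp g' b <->
      subset A b /\ trace w h A b ∈ fapp g b /\ cip w b (fapp g b))).
    { intros b A Hb. rewrite E by auto. rewrite in_cmp by (unfold trace; dfn).
      now rewrite in_power. }
    (* Countable intersections are used twice: [g b] gives a u in all the traces, then [h u] gives a
       point in all the members of the sequence. *)
    assert (HC : forall b, b ∈ a -> (exists A, A ∈ fapp g' b) -> cip w b (fapp g' b)).
    { intros b Hb HA. assert (Ob := ord_mem Ha Hb). split; auto. split.
      { intros A K. now apply HE in K. }
      intros F HF. destruct HA as [A0 HA0]. apply HE in HA0 as [_ [_ [_ [_ Cg]]]]; auto.
      destruct (@bounded_fun D Z w (fapp g b) (fun n => trace w h (fapp F n) b)) as [S [HS ES]].
      - unfold trace; dfn.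
      - intros n Hn. assert (K := fun_into_fapp HF Hn). apply HE in K; tauto.
      - destruct (Cg S HS) as [u [Hu K]].
        assert (K' : forall n, n ∈ w -> inter (fapp F n) u ∈ fapp h u /\ cip w u (fapp h u)).
        { intros n Hn. assert (L := K n Hn). rewrite ES in L by auto.
          apply in_trace in L. tauto. }
        destruct (proj2 (K' n0 Hn0)) as [_ [_ Ch]].
        destruct (@bounded_fun D Z w (fapp h u) (fun n => inter (fapp F n) u)) as [S' [HS' ES']].
        + dfn.
        + intros n Hn. now apply K'.
        + destruct (Ch S' HS') as [v [Hv L]]. exists v. split.
          * eapply ord_trans; eauto.
          * intros n Hn. assert (M := L n Hn). rewrite ES' in M by auto.
            now apply in_inter in M. }
    exists g'. split; [now apply fun_in_power_cart|]. split.
    + intros A HA. assert (K := Hg _ (Hh A HA)).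
      replace (trace w g' A a) with (trace w g (trace w h A a) a); auto.
      assert (EI : forall b, b ∈ a ->
        (inter A b ∈ fapp g' b <-> inter (trace w h A a) b ∈ fapp g b /\ cip w b (fapp g b))).
      { intros b Hb. rewrite HE, trace_inter with (a := a) by auto. split; [tauto|].
        intros H. split; auto. intros x Hx. now apply in_inter in Hx. }
      apply ext. intros b. rewrite !(in_trace w _ _ a b). split.
      * intros [Hb H]. apply EI in H; auto. split; auto. split; auto. apply HC; auto.
        now exists (inter A b).
      * intros [Hb [H _]]. apply EI in H; auto.
    + intros b Hb HA. split; auto. exists h. intros A K. apply HE in K; tauto.
Qed.

(** Without a minimal element, dependent choice yields functions g_n whose limits along [mu0]
    contain members of [E], with g_(n+1) b below g_n b wherever g_(n+1) b is nonempty. Countable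
    intersections for [mu0] give a single b < a at which all g_n b are nonempty and have the
    property [cip]. These g_n b have no minimal element, against the induction hypothesis at b. *)
Theorem limit_below_minimal w : is_limit w -> forall a E, is_ordinal a ->
  (forall nu, nu ∈ E -> cip w a nu) -> (exists nu, nu ∈ E) ->
  exists mu, mu ∈ E /\ forall nu, nu ∈ E -> ~ limit_below w a nu mu.
Proof.
  intros Lw. assert (Lw' := Lw). destruct Lw' as [_ [[n0 Hn0] Sw]].
  induction a as [a IH] using (well_founded_ind W). intros E Ha HE [mu0 Hmu0].
  apply NNPP; intros N.
  assert (Step : forall mu, mu ∈ E -> exists nu, nu ∈ E /\ limit_below w a nu mu).
  { intros mu Hmu. apply NNPP; intros K. apply N. exists mu. split; auto.
    intros nu Hnu L. apply K. now exists nu. }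
  set (C := cmp (power (cart a (power (power a))))
    (fun g => exists nu, nu ∈ E /\ limit_by w a nu mu0 g)).
  assert (HC : forall g, g ∈ C <-> g ∈ power (cart a (power (power a))) /\
    exists nu, nu ∈ E /\ limit_by w a nu mu0 g).
  { intros g. unfold C. rewrite in_cmp by dfn. reflexivity. }
  destruct (Step mu0 Hmu0) as [nu1 [Hnu1 [h1 Hh1]]].
  destruct (limit_by_function Ha Hh1) as [g1 [Pg1 Hg1]].
  destruct (@dependent_choice D Z W w g1 C (fun g g' => forall b, b ∈ a ->
      (exists A, A ∈ fapp g' b) -> cip w b (fapp g' b) /\
        exists h, limit_by w b (fapp g' b) (fapp g b) h)) as [F [HF RF]].
  - dfn.
  - auto.
  - apply HC. split; auto. now exists nu1.
  - intros g Hg. apply HC in Hg as [Pg [nu [Hnu Hg]]].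
    destruct (Step nu Hnu) as [nu' [Hnu' L]].
    destruct (limit_step Lw Ha Hg L) as [g' [Pg' [Lg' Rg']]].
    exists g'. split; auto. apply HC. split; auto. now exists nu'.
  - destruct (HE mu0 Hmu0) as [_ [Sub Cip]].
    destruct (@bounded_choice D Z w mu0 (fun n B => forall b, b ∈ B ->
      b ∈ a /\ (exists A, A ∈ fapp (fapp F n) b) /\ cip w b (fapp (fapp F n) b)))
      as [B [HB EB]]; [dfn| |].
    + intros n Hn. assert (K := fun_into_fapp HF Hn). apply HC in K as [_ [nu [Hnu K]]].
      destruct (HE nu Hnu) as [[A HA] _].
      exists (trace w (fapp F n) A a). split; auto. intros b Hb. apply in_trace in Hb as [H1 [H2 H3]].
      split; auto. split; auto. now exists (inter A b).
    + destruct (Cip B HB) as [b [Hb Kb]].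
      assert (Ob := ord_mem Ha Hb).
      destruct (@def2_replacement D Z (fun n x => x = fapp (fapp F n) b) w) as [E' HE']; [dfn| |].
      { intros n _. exists (fapp (fapp F n) b). split; auto. }
      destruct (IH b Hb E' Ob) as [mu [Hmu M]].
      * intros nu Hnu. apply HE' in Hnu as [n [Hn ->]]. apply (EB n Hn b); auto.
      * exists (fapp (fapp F n0) b). apply HE'. now exists n0.
      * apply HE' in Hmu as [n [Hn ->]].
        apply (M (fapp (fapp F (succ n)) b)).
        -- apply HE'. exists (succ n). split; auto.
        -- apply (RF n Hn b Hb). apply (EB (succ n) (Sw n Hn) b); auto.
Qed.

Lemma normal_measure_cip w kappa mu : is_omega w -> normal_measure kappa mu -> cip w kappa mu.
Proof.
  intros Ow Hmu. split; [|split].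
  - exists kappa. apply Hmu.
  - apply Hmu.
  - intros F HF.
    assert (K : measure_one kappa mu (fun x => forall n, n ∈ w -> x ∈ fapp F n)).
    { apply (ae_complete Hmu); [dfn|now apply (omega_mem Hmu)|].
      intros n Hn. exists (fapp F n). assert (L := fun_into_fapp HF Hn). split; auto.
      intros x. split; [|tauto]. intros Hx. split; auto.
      destruct Hmu as [_ [[Sub _] _]]. exact (Sub _ L x Hx). }
    destruct (ae_exists Hmu K) as [x [Hx L]]. now exists x.
Qed.

(** The function [h] representing [nu] modulo [mu] is the witness once almost every h x has
    countable intersections. If not, choose bad sequences G x; each x |-> G x n is almost everywhere
    B_n ∩ x with B_n in [nu], and a common point of the B_n lies in every G x n for almost all x. *)
Lemma mitchell_lt_limit_below w kappa nu mu : is_omega w -> mitchell_lt kappa nu mu ->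
  limit_below w kappa nu mu.
Proof.
  intros Ow [Hnu [Hmu HU]].
  destruct (in_Ult_represents Hmu HU) as [h [Fh [Ph Rh]]]; [apply Hnu|].
  assert (Ok := kappa_ord Hmu).
  assert (Sub : forall A, A ∈ nu -> subset A kappa) by apply Hnu.
  assert (Hw : w ∈ kappa) by now apply (omega_mem Hmu).
  assert (C : measure_one kappa mu (fun x => forall F, is_fun_into F w (fapp h x) ->
    exists u, u ∈ x /\ forall n, n ∈ w -> u ∈ fapp F n)).
  { apply NNPP; intros N. apply (ae_not Hmu) in N; [|dfn].
    destruct (@ae_choice _ _ _ _ Hmu (power (cart w (power kappa)))
      (fun x F => is_fun_into F w (fapp h x) /\
        ~ exists u, u ∈ x /\ forall n, n ∈ w -> u ∈ fapp F n)) as [G [[FG _] HG]]; [dfn| |].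
    { eapply (ae_mono Hmu); [dfn|exact N|]. intros x Hx K.
      apply not_all_ex_not in K as [F K]. apply imply_to_and in K as [K1 K2].
      exists F. split; auto. apply fun_in_power_cart. apply fun_into_intro; [apply K1|].
      intros n Hn. assert (L := fun_into_fapp K1 Hn). apply Ph in L; auto.
      apply in_power in L. apply in_power. intros u Hu.
      apply (ord_subset_kappa Hmu Hx). auto. }
    destruct (@bounded_choice D Z w nu
      (fun n A => measure_one kappa mu (fun x => fapp (fapp G x) n = inter A x)))
      as [B [HB EB]]; [dfn| |].
    { intros n Hn.
      destruct (ae_restriction Hmu (a := fun x => fapp (fapp G x) n)) as [A [HA EA]]; [dfn| |].
      - eapply (ae_mono Hmu); [dfn|exact HG|]. intros x Hx [K _].
        assert (L := fun_into_fapp K Hn). apply Ph in L; auto. now apply in_power in L.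
      - exists A. split; auto. apply Rh; auto.
        eapply (ae_mono2 Hmu); [dfn|exact HG|exact EA|]. cbv beta. intros x Hx [K _] <-.
        now apply (fun_into_fapp K). }
    destruct (normal_measure_cip Ow Hnu) as [_ [_ Cn]].
    destruct (Cn B HB) as [u [Hu Ku]].
    assert (L : measure_one kappa mu (fun x => forall n, n ∈ w ->
      fapp (fapp G x) n = inter (fapp B n) x)).
    { apply (ae_complete Hmu); auto. dfn. }
    destruct (ae_exists Hmu (ae_and Hmu (ae_and Hmu HG L) (ae_above Hmu Hu)))
      as [x [Hx [[[_ K1] K2] K3]]].
    apply K1. exists u. split; auto. intros n Hn. rewrite K2 by auto. apply in_inter; auto. }
  exists h. intros A HA. unfold trace.
  apply (measure_one_cmp kappa mu (P := fun b => inter A b ∈ fapp h b /\ cip w b (fapp h b))); [dfn|].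
  assert (HA' := HA). apply Rh in HA'; auto.
  eapply (ae_mono2 Hmu); [dfn|exact HA'|exact C|]. cbv beta. intros x Hx K1 K2.
  split; auto. split; [now exists (inter A x)|]. split; auto.
  intros B HB. apply in_power. now apply (Ph x Hx).
Qed.

Theorem mitchell_lt_minimal kappa E :
  (forall nu, nu ∈ E -> normal_measure kappa nu) -> (exists nu, nu ∈ E) ->
  exists mu, mu ∈ E /\ forall nu, nu ∈ E -> ~ mitchell_lt kappa nu mu.
Proof.
  intros HE [nu0 Hnu0]. destruct omega_exists as [w Ow].
  destruct (@limit_below_minimal w (proj1 Ow) kappa E) as [mu [Hmu M]].
  - exact (kappa_ord (HE nu0 Hnu0)).
  - intros nu Hnu. apply normal_measure_cip; auto.
  - now exists nu0.
  - exists mu. split; auto. intros nu Hnu K. apply (M nu Hnu). now apply mitchell_lt_limit_below.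
Qed.

(** A is in [nu] when {b < kappa : A ∩ b ∈ h b} is in [mu]. The part of this set below a is computed
    from A ∩ a, and [g a] decides it; so [nu] is represented modulo [rho] by a function built from
    [h] and [g]. *)
Lemma mitchell_lt_trans kappa nu mu rho :
  mitchell_lt kappa nu mu -> mitchell_lt kappa mu rho -> mitchell_lt kappa nu rho.
Proof.
  intros [Hnu [Hmu HU]] [_ [Hrho HU']]. split; auto. split; auto.
  destruct (in_Ult_represents Hmu HU) as [h [Fh [Ph Rh]]]; [apply Hnu|].
  destruct (in_Ult_represents Hrho HU') as [g [Fg [Pg Rg]]]; [apply Hmu|].
  assert (Ok := kappa_ord Hmu).
  destruct (@bounded_fun D Z kappa (power (power kappa)) (fun a => cmp (power a)
    (fun A => cmp a (fun b => inter A b ∈ fapp h b) ∈ fapp g a))) as [k [[Fk _] Ek]]; [dfn| |].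
  { intros a Ha. apply in_power. intros A HA. rewrite in_cmp, in_power in HA by dfn.
    apply in_power. intros x Hx. eapply ord_trans; eauto. now apply HA. }
  apply (represents_in_Ult Hrho (X := nu) (h := k)); [apply Hnu|]. split; auto. split.
  - intros a Ha A HA. rewrite Ek, in_cmp in HA by (auto || dfn). tauto.
  - intros A HA. rewrite (Rh A HA).
    rewrite measure_one_cmp by dfn.
    rewrite Rg by (intros x Hx; rewrite in_cmp in Hx by dfn; tauto).
    assert (K : forall a, a ∈ kappa -> (inter A a ∈ fapp k a <->
      inter (cmp kappa (fun b => inter A b ∈ fapp h b)) a ∈ fapp g a)).
    { intros a Ha. rewrite Ek, in_cmp by (auto || dfn).
      replace (cmp a (fun b => inter (inter A a) b ∈ fapp h b))
        with (inter (cmp kappa (fun b => inter A b ∈ fapp h b)) a).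
      - split; [tauto|]. intros H; split; auto. apply in_power. intros x Hx.
        now apply in_inter in Hx.
      - assert (Oa := ord_mem Ok Ha). apply ext. intros b. rewrite in_inter, !in_cmp by dfn.
        split.
        + intros [[_ H] Hb]. rewrite inter_inter; auto.
        + intros [Hb H]. rewrite inter_inter in H by auto. split; auto. split; auto.
          eapply ord_trans; eauto. }
    split; intros H; (eapply (ae_mono Hrho); [dfn|exact H|]); intros a Ha; apply K; auto.
Qed.

End WellFoundedness.

(** * The Mitchell rank *)

Section MitchellRank.
Context {D : structure} {Z : ZFC D} {W : well_founded (@mem D)}.
Implicit Types (a b c d e f g h o p q r x y z A B E mu nu kappa theta : D).

Lemma normal_measures_set kappa :
  exists d, forall mu, mu ∈ d <-> normal_measure kappa mu.
Proof.
  exists (cmp (power (power kappa)) (fun mu => normal_measure kappa mu)).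
  intros mu. rewrite in_cmp by dfn. split; [tauto|]. intros H. split; auto.
  apply in_power. intros A HA. apply in_power. revert A HA. apply H.
Qed.

(** Recursion is available along the ordinals, so a hierarchy is built: G a holds the measures all
    of whose predecessors occur at a stage below a. The rank is the first stage of occurrence, and
    well-foundedness makes every measure occur. *)
Lemma mitchell_rank_exists kappa : exists r, is_mitchell_rank kappa r.
Proof.
  destruct (normal_measures_set kappa) as [d Hd].
  destruct (@transfinite_recursion D Z W (fun a p => cmp d (fun nu =>
    forall mu, mitchell_lt kappa mu nu -> exists b, b ∈ a /\ mu ∈ fapp p b)))
    as [G [DG HG]]; [dfn|].
  assert (GE : forall a nu, is_ordinal a -> (nu ∈ G a <-> nu ∈ d /\
    forall mu, mitchell_lt kappa mu nu -> exists b, b ∈ a /\ mu ∈ G b)).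
  { intros a nu Ha. destruct (HG a Ha) as [p [_ [Ep ->]]]. rewrite in_cmp by dfn.
    apply and_iff_compat_l.
    split; intros H mu Hmu; destruct (H mu Hmu) as [b [Hb K]]; exists b; split; auto.
    - now rewrite <- Ep.
    - now rewrite Ep. }
  set (Rk := fun nu a => is_ordinal a /\ nu ∈ G a /\ forall b, b ∈ a -> ~ nu ∈ G b).
  assert (DR : def2 Rk) by (unfold Rk; dfn).
  assert (RU : forall nu a b, Rk nu a -> Rk nu b -> a = b).
  { intros nu a b [Oa [Ga Ma]] [Ob [Gb Mb]].
    destruct (ord_total Oa Ob) as [H|[H|H]]; auto; exfalso.
    - exact (Mb a H Ga).
    - exact (Ma b H Gb). }
  assert (RE : forall nu, (exists a, is_ordinal a /\ nu ∈ G a) -> exists a, Rk nu a).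
  { intros nu H. destruct (least_ordinal H) as [a [Oa [Ga M]]]. exists a.
    split; auto. split; auto. intros b Hb K.
    exact (ord_subset_not_mem (M b (ord_mem Oa Hb) K) Hb). }
  assert (All : forall nu, nu ∈ d -> exists a, Rk nu a).
  { intros nu0 Hnu0. apply NNPP; intros N.
    destruct (@mitchell_lt_minimal D Z W kappa (cmp d (fun nu => ~ exists a, Rk nu a)))
      as [nu [Hnu M]].
    - intros nu Hnu. rewrite in_cmp in Hnu by dfn. now apply Hd.
    - exists nu0. rewrite in_cmp by dfn. auto.
    - rewrite in_cmp in Hnu by dfn. destruct Hnu as [Hnu K]. apply K.
      assert (P : forall mu, mitchell_lt kappa mu nu -> exists a, Rk mu a).
      { intros mu Hmu. apply NNPP; intros L. apply (M mu); auto.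
        rewrite in_cmp by dfn. split; auto. apply Hd, Hmu. }
      destruct (@def2_replacement D Z Rk (cmp d (fun mu => mitchell_lt kappa mu nu)) DR)
        as [O HO].
      { intros mu Hmu. rewrite in_cmp in Hmu by dfn. destruct (P mu) as [a Ha]; [tauto|].
        exists a. split; auto. intros a' Ha'. now apply (RU mu). }
      destruct (@strict_sup_exists D Z W O) as [o [Oo [So _]]].
      { intros a Ha. apply HO in Ha as [mu [_ [Ha _]]]; auto. }
      apply RE. exists o. split; auto. apply GE; auto. split; auto.
      intros mu Hmu. destruct (P mu Hmu) as [a Ha]. exists a. split; [|apply Ha].
      apply So, HO. exists mu. split; auto. rewrite in_cmp by dfn. split; auto.
      apply Hd, Hmu. }
  destruct (@def2_replacement D Z Rk d DR) as [O HO].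
  { intros nu Hnu. destruct (All nu Hnu) as [a Ha]. exists a. split; auto.
    intros a' Ha'. now apply (RU nu). }
  destruct (@bounded_choice D Z d O Rk DR) as [r [[Fr _] Er]].
  { intros nu Hnu. destruct (All nu Hnu) as [a Ha]. exists a. split; auto.
    apply HO. now exists nu. }
  exists r, d. split; auto. split; auto. intros nu a Hnu Hra.
  apply (app_fun _ _ Fr) in Hra as [_ ->].
  destruct (Er nu Hnu) as [Oa [Ga Ma]]. split; auto. split.
  - intros b [mu [Hmu Hb]]. apply (app_fun _ _ Fr) in Hb as [Hmud ->].
    apply GE in Ga as [_ Ga]; auto. destruct (Ga mu Hmu) as [c [Hc K]].
    assert (Oc := ord_mem Oa Hc). destruct (Er mu Hmud) as [Ob [_ Mb]].
    destruct (ord_total Ob Oc) as [L|[L|L]].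
    + eapply ord_trans; eauto.
    + now rewrite L.
    + exfalso. exact (Mb c L K).
  - intros o' Oo' H. apply ord_not_mem; auto. intros K. apply (Ma o' K).
    apply GE; auto. split; auto. intros mu Hmu.
    assert (Hmud : mu ∈ d) by apply Hd, Hmu.
    exists (fapp r mu). split; [|now apply Er].
    apply H. exists mu. split; auto. now apply (app_fun _ _ Fr).
Qed.

Section Rank.
Variables kappa r : D.
Hypothesis Hr : is_mitchell_rank kappa r.
Notation normal := (normal_measure kappa).

Lemma rank_app mu b : app r mu b <-> normal mu /\ b = fapp r mu.
Proof. destruct Hr as [d [Hd [Fr _]]]. rewrite (app_fun _ _ Fr), Hd. reflexivity. Qed.

Lemma rank_strict_sup nu : normal nu ->
  is_strict_sup (fun b => exists mu, mitchell_lt kappa mu nu /\ app r mu b) (fapp r nu).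
Proof.
  intros Hnu. destruct Hr as [d [Hd [Fr K]]]. apply K; [now apply Hd|].
  now apply rank_app.
Qed.

Lemma rank_ord nu : normal nu -> is_ordinal (fapp r nu).
Proof. intros H. apply (rank_strict_sup H). Qed.

Lemma rank_lt mu nu : mitchell_lt kappa mu nu -> fapp r mu ∈ fapp r nu.
Proof.
  intros H. destruct (rank_strict_sup (proj1 (proj2 H))) as [_ [K _]].
  apply K. exists mu. split; auto. apply rank_app. split; auto. apply H.
Qed.

Lemma rank_above nu b : normal nu -> b ∈ fapp r nu ->
  exists mu, mitchell_lt kappa mu nu /\ ~ fapp r mu ∈ b.
Proof.
  intros Hnu Hb. apply NNPP; intros N.
  destruct (rank_strict_sup Hnu) as [Oo [_ K]].
  assert (L : subset (fapp r nu) b).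
  { apply K; [eapply ord_mem; eauto|]. intros c [mu [Hmu Hc]].
    apply rank_app in Hc as [_ ->]. apply NNPP; intros M. apply N. now exists mu. }
  exact (ord_subset_not_mem L Hb).
Qed.

(** Take a predecessor of [nu] of least rank among those of rank at least b. Were its rank above b,
    it would itself have a predecessor of rank at least b, which by transitivity is a predecessor of
    [nu] of smaller rank. *)
Lemma rank_onto nu b : normal nu -> b ∈ fapp r nu ->
  exists mu, mitchell_lt kappa mu nu /\ fapp r mu = b.
Proof.
  intros Hnu Hb. assert (Ob := ord_mem (rank_ord Hnu) Hb).
  destruct (least_ordinal (P := fun a => exists mu, mitchell_lt kappa mu nu /\
    ~ fapp r mu ∈ b /\ fapp r mu = a)) as [a [Oa [[mu [Hmu [Nb <-]]] M]]].
  - destruct (rank_above Hnu Hb) as [mu [Hmu K]]. exists (fapp r mu).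
    split; [apply rank_ord, Hmu|]. now exists mu.
  - exists mu. split; auto. destruct (ord_total Oa Ob) as [H|[H|H]]; [tauto|auto|].
    exfalso. destruct (rank_above (proj1 Hmu) H) as [mu' [Hmu' K]].
    apply (ord_subset_not_mem (M (fapp r mu') (rank_ord (proj1 Hmu'))
      (ex_intro _ mu' (conj (mitchell_lt_trans Hmu' Hmu) (conj K eq_refl))))).
    now apply rank_lt.
Qed.

(* The families of subsets of kappa in Ult(V, nu) are represented by functions
   picking one of fewer than kappa many families of subsets of alpha, that is, by
   functions u from kappa to kappa. Modulo nu such a u is coded by a subset B of
   kappa: if u is regressive then it is constant and B is the singleton of its
   value, otherwise B is the range of u on closure points of u, so that u alpha is
   the least element of B above alpha. *)
Definition decodes B a x :=
  x ∈ B /\ ((forall y, y ∈ B -> y = x) \/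
            (~ x ∈ a /\ forall y, y ∈ B -> ~ y ∈ a -> x = y \/ x ∈ y)).

#[local] Instance Rel3_decodes j : Rel3 j decodes decodes.
Proof. unfold decodes; dfn. Qed.

Lemma code_exists nu u : normal nu -> is_fun_into u kappa kappa ->
  exists B, subset B kappa /\
    measure_one kappa nu (fun a => forall x, decodes B a x <-> x = fapp u a).
Proof.
  intros Hnu Hu. assert (Ok := kappa_ord Hnu).
  assert (Ou : forall a, a ∈ kappa -> is_ordinal (fapp u a)).
  { intros a Ha. apply (ord_mem Ok). now apply (fun_into_fapp Hu). }
  destruct (classic (measure_one kappa nu (fun a => fapp u a ∈ a))) as [H|H].
  - destruct (fodor Hnu (g := fapp u)) as [c [Hc K]]; [dfn|auto|].
    exists (upair c c). split.
    + intros x Hx. apply in_upair in Hx as [->| ->]; auto.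
    + eapply (ae_mono Hnu); [unfold decodes; dfn|exact K|]. cbv beta. intros a Ha -> x.
      unfold decodes. rewrite in_upair. split; [tauto|]. intros ->. split; auto. left.
      intros y Hy. apply in_upair in Hy; tauto.
  - apply (ae_not Hnu) in H; [|dfn].
    set (closed := fun a => ~ fapp u a ∈ a /\ forall b, b ∈ a -> fapp u b ∈ a).
    assert (HS : measure_one kappa nu closed).
    { apply (ae_and Hnu H). apply (ae_diagonal Hnu); [dfn|]. intros b Hb.
      apply (ae_above Hnu). now apply (fun_into_fapp Hu). }
    exists (cmp kappa (fun x => exists a, a ∈ kappa /\ closed a /\ x = fapp u a)).
    assert (HB : forall x, x ∈ cmp kappa (fun x => exists a, a ∈ kappa /\ closed a /\ x = fapp u a)
      <-> exists a, a ∈ kappa /\ closed a /\ x = fapp u a).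
    { intros x. rewrite in_cmp by (unfold closed; dfn). split; [tauto|]. intros K. split; auto.
      destruct K as [a [Ha [_ ->]]]. now apply (fun_into_fapp Hu). }
    split; [intros x Hx; apply HB in Hx as [a [Ha [_ ->]]]; now apply (fun_into_fapp Hu)|].
    eapply (ae_mono Hnu); [unfold closed; dfn|exact HS|]. intros a Ha Ca x.
    assert (La : fapp u a ∈ cmp kappa (fun x => exists a, a ∈ kappa /\ closed a /\ x = fapp u a)).
    { apply HB. exists a; auto. }
    (* For closure points a < b one has u a < b <= u b, while b < a gives u b < a. *)
    assert (M : forall y, y ∈ cmp kappa (fun x => exists a, a ∈ kappa /\ closed a /\ x = fapp u a) ->
      ~ y ∈ a -> fapp u a = y \/ fapp u a ∈ y).
    { intros y Hy Ny. apply HB in Hy as [b [Hb [Cb ->]]].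
      destruct (ord_total (ord_mem Ok Ha) (ord_mem Ok Hb)) as [K|[->|K]]; auto.
      - right. apply (ord_not_mem (Ou b Hb) (ord_mem Ok Hb) (proj1 Cb)). now apply Cb.
      - exfalso. apply Ny. now apply Ca. }
    unfold decodes. split.
    + intros [Hx [K|[Nx K]]]; [symmetry; now apply K|].
      destruct (M x Hx Nx) as [E|E]; auto.
      destruct (K _ La (proj1 Ca)) as [E'|E']; auto.
      exfalso. exact (mem_asym E E').
    + intros ->. split; auto. right. split; auto. apply Ca.
Qed.

Lemma rank_covered nu : normal nu ->
  (forall a, a ∈ kappa -> exists b e, b ∈ kappa /\ is_fun_into e b (power (power a)) /\
     forall x, x ∈ power (power a) -> exists u, u ∈ b /\ fapp e u = x) ->
  covers (power kappa) (fapp r nu).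
Proof.
  intros Hnu Hs. assert (Ok := kappa_ord Hnu).
  destruct (@bounded_choice D Z kappa (power (cart kappa (power (power kappa))))
    (fun a e => exists b, b ∈ kappa /\ is_fun_into e b (power (power a)) /\
     forall x, x ∈ power (power a) -> exists u, u ∈ b /\ fapp e u = x))
    as [E [_ HE]]; [dfn| |].
  { intros a Ha. destruct (Hs a Ha) as [b [e [Hb [He S]]]]. exists e.
    split; [|exists b; auto]. apply in_power. intros p Hp.
    assert (K := fun_in_power_cart He). rewrite in_power in K. assert (L := K p Hp).
    apply in_cart in L as [x [y [Hx [Hy ->]]]]. apply pair_in_cart. split.
    - eapply ord_trans; eauto.
    - apply in_power. intros A HA. rewrite in_power in Hy. apply Hy in HA.
      rewrite in_power in HA. apply in_power. intros v Hv. apply (ord_trans Ok Ha). now apply HA. }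
  (* [B] codes [mu] when [mu] is represented modulo [nu] by picking from the enumeration E a the
     family whose index is decoded from [B] at a. The code determines [mu], hence its rank. *)
  set (code := fun B mu => forall A, A ∈ power kappa -> (A ∈ mu <->
    measure_one kappa nu (fun a => exists x, decodes B a x /\ inter A a ∈ fapp (fapp E a) x))).
  apply relation_covers with (Q := fun B b => exists mu, mitchell_lt kappa mu nu /\
    code B mu /\ b = fapp r mu).
  - unfold code; dfn.
  - intros B b b' [mu [Hmu [Cmu ->]]] [mu' [Hmu' [Cmu' ->]]]. f_equal.
    assert (S : forall m, mitchell_lt kappa m nu -> forall A, A ∈ m -> A ∈ power kappa).
    { intros m Hm A HA. apply in_power. revert A HA. apply Hm. }
    apply ext. intros A. split; intros HA.
    + apply Cmu'; [eauto|]. apply Cmu; eauto.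
    + apply Cmu; [eauto|]. apply Cmu'; eauto.
  - intros b Hb. destruct (rank_onto Hnu Hb) as [mu [Hmu <-]].
    destruct Hmu as [Nmu [_ HU]].
    destruct (in_Ult_represents Hnu HU) as [h [Fh [Ph Rh]]]; [apply Nmu|].
    destruct (@bounded_choice D Z kappa kappa (fun a x => fapp (fapp E a) x = fapp h a))
      as [u [Hu Eu]]; [dfn| |].
    { intros a Ha. destruct (HE a Ha) as [c [Hc [_ S]]].
      destruct (S (fapp h a)) as [x [Hx K]].
      - apply in_power. exact (Ph a Ha).
      - exists x. split; auto. eapply ord_trans; eauto. }
    destruct (code_exists Hnu Hu) as [B [HB CB]].
    exists B. split; [now apply in_power|]. exists mu. split; [split; auto|]. split; auto.
    intros A HA. apply in_power in HA. rewrite Rh by auto.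
    split; intros H; (eapply (ae_mono2 Hnu); [dfn|exact H|exact CB|]); cbv beta.
    + intros a Ha K L. exists (fapp u a). split; [now apply L|]. now rewrite Eu.
    + intros a Ha [x [K1 K2]] L. apply L in K1. subst x. now rewrite Eu in K2.
Qed.

(** If [o] were below [theta], the least strict bound o' of all ranks would be covered by P(kappa).
    For every A choose a measure of rank at least the ordinal that A covers; a common upper bound of
    these measures has rank at least o'. *)
Lemma rank_unbounded theta o :
  (forall b, is_ordinal b -> (b ∈ theta <-> covers (power kappa) b)) ->
  is_ordinal theta -> (exists nu, normal nu) ->
  (forall e, is_fun e (power kappa) -> (forall A, A ∈ power kappa -> normal (fapp e A)) ->
     exists nu, normal nu /\ forall A, A ∈ power kappa -> mitchell_lt kappa (fapp e A) nu) ->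
  is_ordinal o -> (forall nu, normal nu -> fapp r nu ∈ o) -> subset theta o.
Proof.
  intros Ht Ot [nu0 Hnu0] Hlow Oo Ho. apply ord_not_mem; auto. intros K.
  destruct (least_ordinal (P := fun o => forall nu, normal nu -> fapp r nu ∈ o))
    as [o' [Oo' [Ho' M]]]; [now exists o|].
  assert (C : covers (power kappa) o').
  { apply (covers_subset (proj1 (Ht o Oo) K)). now apply M. }
  destruct C as [q [Fq Sq]].
  destruct (normal_measures_set kappa) as [d Hd].
  destruct (@bounded_choice D Z (power kappa) d
    (fun A nu => fapp q A ∈ o' -> ~ fapp r nu ∈ fapp q A)) as [e [He Ee]]; [dfn| |].
  { intros A _. destruct (classic (fapp q A ∈ o')) as [H|H].
    - apply NNPP; intros N.
      assert (Oq := ord_mem Oo' H).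
      apply (ord_subset_not_mem (b := o') (a := fapp q A)); auto. apply M; auto.
      intros nu Hnu. apply NNPP; intros L. apply N. exists nu. split; auto. now apply Hd.
    - exists nu0. split; [now apply Hd|tauto]. }
  assert (Ne : forall A, A ∈ power kappa -> normal (fapp e A)).
  { intros A HA. apply Hd. now apply (fun_into_fapp He). }
  destruct (Hlow e (proj1 He) Ne) as [nu [Hnu Lnu]].
  apply (ord_subset_not_mem (b := o') (a := fapp r nu)); auto.
  intros b Hb. destruct (Sq b Hb) as [A [HA EA]].
  assert (L := rank_lt (Lnu A HA)). assert (N := Ee A HA). rewrite EA in N.
  assert (Ob := ord_mem Oo' Hb). assert (Oe := rank_ord (Ne A HA)).
  assert (On := rank_ord Hnu).
  destruct (ord_total Oe Ob) as [Q|[Q|Q]].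
  - exfalso. now apply N.
  - now rewrite <- Q.
  - eapply ord_trans; eauto.
Qed.

End Rank.

Theorem mitchell_order_succ_pow kappa :
  (exists nu, normal_measure kappa nu) ->
  (forall a, a ∈ kappa -> exists b e, b ∈ kappa /\ is_fun_into e b (power (power a)) /\
     forall x, x ∈ power (power a) -> exists u, u ∈ b /\ fapp e u = x) ->
  (forall e, is_fun e (power kappa) ->
     (forall A, A ∈ power kappa -> normal_measure kappa (fapp e A)) ->
     exists nu, normal_measure kappa nu /\
       forall A, A ∈ power kappa -> mitchell_lt kappa (fapp e A) nu) ->
  mitchell_order_eq_succ_pow kappa.
Proof.
  intros Hn Hs Hlow. destruct (mitchell_rank_exists kappa) as [r Hr].
  destruct (succ_cardinality (power kappa)) as [lambda [theta [Hl [Ht Ct]]]].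
  assert (Ot : is_ordinal theta) by apply Ht.
  exists theta, (power kappa), lambda. split; [|split; [|split]]; auto.
  - exists r. split; auto. split; auto. split.
    + intros b [nu Hb]. apply (rank_app Hr) in Hb as [Hnu ->].
      apply Ct; [exact (rank_ord Hr Hnu)|]. now apply rank_covered.
    + intros o Oo K. apply (rank_unbounded Hr Ct Ot Hn Hlow Oo).
      intros nu Hnu. apply K. exists nu. now apply (rank_app Hr).
  - intros y. apply in_power.
Qed.

End MitchellRank.

(** * The derived ultrafilter *)

Section DerivedUltrafilter.
Context {D : structure} {Z : ZFC D} {W : well_founded (@mem D)}.
Implicit Types (a b c d e f g h o p q r x y z A B X mu nu : D).
Variable j : D -> D.
Hypothesis j_elem : elementary j.
Variable kappa : D.
Hypothesis j_crit : critical_point j kappa.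
Variable U : D.
Hypothesis U_def : derived_ultrafilter j kappa U.

Lemma in_derived X : X ∈ U <-> subset X kappa /\ kappa ∈ j X.
Proof. exact (U_def X). Qed.

Lemma elementary_iff (P P' : Prop) : dfn j (fun _ => P) (fun _ => P') -> (P <-> P').
Proof. intros H. exact (dfn_transfer (fun _ => kappa) j_elem H). Qed.

Lemma j_mem x y : x ∈ y <-> j x ∈ j y.
Proof. apply elementary_iff. dfn. Qed.

Lemma j_eq x y : x = y <-> j x = j y.
Proof. apply elementary_iff. dfn. Qed.

Lemma j_ordinal x : is_ordinal x <-> is_ordinal (j x).
Proof. apply elementary_iff. dfn. Qed.

Lemma j_fix x : x ∈ kappa -> j x = x.
Proof. apply j_crit. Qed.

Lemma crit_mem : kappa ∈ j kappa.
Proof.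
  destruct j_crit as [Ok [N F]].
  destruct (ord_total Ok (proj1 (j_ordinal kappa) Ok)) as [H|[H|H]]; auto.
  - now destruct N.
  - destruct N. apply j_eq. now apply F.
Qed.

(** Ordinals below kappa are fixed, and those from kappa on have images above kappa. *)
Lemma crit_not_in_range x : j x <> kappa.
Proof.
  intros E. destruct j_crit as [Ok [N F]].
  assert (Ox : is_ordinal x) by (apply j_ordinal; now rewrite E).
  destruct (ord_total Ox Ok) as [H|[->|H]]; auto.
  - rewrite (F x H) in E. subst x. exact (mem_irrefl H).
  - apply j_mem in H. rewrite E in H. exact (mem_asym crit_mem H).
Qed.

Lemma inter_j A : subset A kappa -> inter (j A) kappa = A.
Proof.
  intros HA. apply ext. intros x. rewrite in_inter. split.
  - intros [H K]. apply j_mem. now rewrite (j_fix K).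
  - intros K. assert (H := K). split; auto. apply j_mem in H. now rewrite (j_fix (HA x K)) in H.
Qed.

Lemma j_subset_fix A a : a ∈ kappa -> subset A a -> j A = A.
Proof.
  intros Ha HA. assert (Ok := proj1 j_crit).
  assert (K : subset (j A) (j a)) by (apply (elementary_iff (P := subset A a)); [dfn|auto]).
  rewrite (j_fix Ha) in K. apply ext. intros x. split; intros Hx.
  - assert (L := ord_trans Ok Ha (K x Hx)). apply j_mem. now rewrite (j_fix L).
  - assert (L := ord_trans Ok Ha (HA x Hx)). apply j_mem in Hx. now rewrite (j_fix L) in Hx.
Qed.

(** [j] sends {alpha < kappa : P alpha} to {alpha < j kappa : P' alpha}, and kappa < j kappa. This
    replaces Łoś's theorem for [U]. *)
Lemma measure_one_derived (P P' : D -> Prop) : Rel1 j P P' ->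
  (measure_one kappa U P <-> P' kappa).
Proof.
  intros HP. assert (HP0 : def1 P) by exact (dfn_left HP).
  rewrite measure_one_cmp by auto. rewrite in_derived.
  assert (E : forall z, z ∈ j (cmp kappa P) <-> z ∈ j kappa /\ P' z).
  { apply (@elementary_iff (forall z, z ∈ cmp kappa P <-> z ∈ kappa /\ P z)); [dfn|].
    intros z. now apply in_cmp. }
  rewrite E. split; [tauto|]. intros H. split; [|split; auto; apply crit_mem].
  intros x Hx. rewrite in_cmp in Hx by auto. tauto.
Qed.

(** For u < kappa the value of j f at u = j u is j (f u), which contains kappa. Both completeness
    and normality reduce to this. *)
Lemma derived_intersection f c : is_fun_into f c U -> forall u, u ∈ c -> u ∈ kappa ->
  forall x, app (j f) u x -> kappa ∈ x.
Proof.
  intros Hf u Hu Hk x Hx. destruct Hf as [Ff Uf].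
  assert (Fj : is_fun (j f) (j c)) by (apply (@elementary_iff (is_fun f c)); [dfn|auto]).
  destruct (proj2 Ff u Hu) as [v [Hv _]].
  assert (Hv' : app (j f) (j u) (j v)) by (apply (@elementary_iff (app f u v)); [dfn|auto]).
  rewrite (j_fix Hk) in Hv'.
  apply (app_fun _ _ Fj) in Hx as [_ ->]. apply (app_fun _ _ Fj) in Hv' as [_ <-].
  now apply in_derived, (Uf u).
Qed.

Lemma derived_normal : normal_measure kappa U.
Proof.
  destruct j_crit as [Ok _].
  split; auto. split; [split; [|split; [|split; [|split]]]|split; [|split]].
  - intros x Hx. now apply in_derived.
  - apply in_derived. split; [intros x; auto|apply crit_mem].
  - intros x y Hx Hxy Hy. apply in_derived in Hx as [_ Hx]. apply in_derived. split; auto.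
    assert (K : subset (j x) (j y)) by (apply (@elementary_iff (subset x y)); [dfn|auto]).
    now apply K.
  - intros x y z Hx Hy Hz. apply in_derived in Hx as [Sx Hx], Hy as [Sy Hy]. apply in_derived. split.
    + intros w Hw. apply Hz in Hw as [Hw _]; auto.
    + assert (K : is_inter (j z) (j x) (j y))
        by (apply (@elementary_iff (is_inter z x y)); [dfn|auto]).
      apply K; auto.
  - intros x y Hx Hy. rewrite !in_derived.
    assert (K : forall z, z ∈ j y <-> z ∈ j kappa /\ ~ z ∈ j x)
      by (apply (@elementary_iff (forall z, z ∈ y <-> z ∈ kappa /\ ~ z ∈ x)); [dfn|auto]).
    assert (L := K kappa). assert (M := crit_mem).
    assert (S : subset y kappa) by (intros z Hz; now apply Hy in Hz). tauto.
  - intros a x Ha Hx K. apply in_derived in K as [_ K].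
    assert (L : is_upair (j x) (j a) (j a))
      by (apply (@elementary_iff (is_upair x a a)); [dfn|auto]).
    apply L in K. assert (N := @crit_not_in_range a). destruct K; congruence.
  - intros c f Hc Hf.
    apply (@measure_one_derived _ (fun x => forall u v, u ∈ j c -> app (j f) u v -> x ∈ v)); [dfn|].
    intros u v Hu. rewrite (j_fix Hc) in Hu.
    apply (derived_intersection Hf Hu). eapply ord_trans; eauto.
  - intros f Hf.
    apply (@measure_one_derived _ (fun x => forall u v, u ∈ x -> app (j f) u v -> x ∈ v)); [dfn|].
    intros u v Hu. now apply (derived_intersection Hf Hu).
Qed.

(** Since A = j A ∩ kappa, A belongs to j(f)(kappa) exactly when A ∩ a ∈ f a for almost all a; so
    [f], cut down to subsets of a, represents [X]. *)
Lemma derived_in_Ult f X : X = fapp (j f) kappa -> (forall A, A ∈ X -> subset A kappa) ->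
  in_Ult kappa U X.
Proof.
  intros E HX. assert (Ok := proj1 j_crit).
  destruct (@bounded_fun D Z kappa (power (power kappa))
    (fun a => cmp (power a) (fun A => A ∈ fapp f a))) as [h [[Fh _] Eh]]; [dfn| |].
  { intros a Ha. apply in_power. intros A HA. rewrite in_cmp, in_power in HA by dfn.
    apply in_power. intros x Hx. apply (ord_trans Ok Ha). now apply HA. }
  apply (represents_in_Ult derived_normal (h := h) HX). split; auto. split.
  - intros a Ha A HA. rewrite Eh, in_cmp in HA by (auto || dfn). tauto.
  - intros A HA. transitivity (measure_one kappa U (fun a => inter A a ∈ fapp f a)).
    + rewrite E, <- (inter_j HA) at 1. symmetry.
      apply (@measure_one_derived _ (fun a => inter (j A) a ∈ fapp (j f) a)). dfn.
    + split; intros H; (eapply (ae_mono derived_normal); [dfn|exact H|]); cbv beta;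
        intros a Ha; rewrite Eh, in_cmp, in_power by (auto || dfn); [|tauto].
      intros K. split; auto. intros x Hx. now apply in_inter in Hx.
Qed.

(* [fapp (j f) kappa] is the element of Ult(V, U) represented by f. *)
Lemma derived_choice b (Q : D -> D -> Prop) : Rel2 j Q Q ->
  (forall a x, a ∈ kappa -> Q a x -> x ∈ b) -> (exists x, Q kappa x) ->
  exists f, Q kappa (fapp (j f) kappa).
Proof.
  intros HQ Hb H. assert (HQ0 : def2 Q) by exact (dfn_left HQ).
  destruct (@ae_choice _ _ _ _ derived_normal b Q HQ0) as [f [_ Hf]].
  - eapply (ae_mono derived_normal) with (P := fun a => exists x, Q a x); [dfn| |].
    + apply (@measure_one_derived _ (fun a => exists x, Q a x)); [dfn|auto].
    + intros a Ha [x Hx]. exists x. split; auto. now apply (Hb a).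
  - exists f. revert Hf.
    apply (@measure_one_derived _ (fun a => Q a (fapp (j f) a))). dfn.
Qed.

Lemma derived_every_subset : every_subset_of_powerset_in_Ult kappa.
Proof.
  assert (Ok := proj1 j_crit). intros X HX. apply NNPP; intros N.
  destruct (@derived_choice (power (power kappa))
    (fun a X => (forall x, x ∈ X -> subset x a) /\
       ~ exists mu, normal_measure a mu /\ in_Ult a mu X)) as [f [H K]].
  - dfn.
  - intros a Y Ha [H _]. apply in_power. intros x Hx. apply in_power. intros u Hu.
    apply (ord_trans Ok Ha). now apply (H x).
  - now exists X.
  - apply K. exists U. split; [apply derived_normal|]. now apply (@derived_in_Ult f).
Qed.

Lemma derived_bounds_measures e : is_fun e (power kappa) ->
  (forall A, A ∈ power kappa -> normal_measure kappa (fapp e A)) ->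
  exists nu, normal_measure kappa nu /\
    forall A, A ∈ power kappa -> mitchell_lt kappa (fapp e A) nu.
Proof.
  assert (Ok := proj1 j_crit). intros He1 He2. apply NNPP; intros N.
  destruct (@derived_choice (power (cart (power kappa) (power (power kappa))))
    (fun a e => is_fun e (power a) /\
       (forall A, A ∈ power a -> normal_measure a (fapp e A)) /\
       ~ exists nu, normal_measure a nu /\
           forall A, A ∈ power a -> mitchell_lt a (fapp e A) nu)) as [f [H1 [H2 H3]]].
  - dfn.
  - intros a e' Ha [F [H _]].
    assert (S : forall A, subset A a -> subset A kappa).
    { intros A HA x Hx. apply (ord_trans Ok Ha). auto. }
    assert (I : is_fun_into e' (power a) (power (power a))).
    { apply fun_into_intro; auto. intros A HA. apply in_power. intros B HB.
      apply in_power. revert B HB. apply (H A HA). }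
    apply fun_in_power_cart in I. rewrite in_power in I. apply in_power. intros p Hp.
    apply I in Hp. apply in_cart in Hp as [x [y [Hx [Hy ->]]]].
    rewrite in_power in Hx, Hy. apply pair_in_cart. split; apply in_power; auto.
    intros A HA. apply Hy in HA. rewrite in_power in HA. apply in_power; auto.
  - exists e. auto.
  - apply H3. exists U. split; [apply derived_normal|]. intros A HA.
    split; auto. split; [apply derived_normal|].
    (* The A-th measure of the family j(f)(kappa) is j(g)(kappa) for g a = f(a)(A ∩ a), because j A
       ∩ kappa = A. Thus it lies in the ultrapower by [U], and [U] bounds the family. *)
    destruct (@image_fun D Z (fun a => fapp (fapp f a) (inter A a)) kappa) as [g [_ Eg]]; [dfn|].
    apply (@derived_in_Ult g); [|apply (H2 A HA)].
    assert (K : forall x, x ∈ j kappa -> fapp (j g) x = fapp (fapp (j f) x) (inter (j A) x)).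
    { apply (@elementary_iff (forall x, x ∈ kappa -> fapp g x = fapp (fapp f x) (inter A x)));
        [dfn|auto]. }
    rewrite (K kappa crit_mem), inter_j; auto. now apply in_power.
Qed.

(** If a bijection e onto P(P(a)) had a domain b of length at least kappa, then kappa < j b and y =
    j(e)(kappa) would be an element of P(P(a)). It is fixed by [j] and equals e(u) for some u, so
    j(e)(j u) = y = j(e)(kappa) and j u = kappa by injectivity. *)
Lemma crit_strong_limit a : a ∈ kappa ->
  exists b e, b ∈ kappa /\ is_fun_into e b (power (power a)) /\
    forall x, x ∈ power (power a) -> exists u, u ∈ b /\ fapp e u = x.
Proof.
  intros Ha. assert (Ok := proj1 j_crit).
  destruct (well_ordering (power (power a))) as [b [Ob [e He]]].
  assert (He' := He). apply bijection_iff in He' as [I [_ S]].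
  exists b, e. split; [|auto]. apply NNPP; intros N.
  assert (Hk : kappa ∈ j b).
  { destruct (ord_total Ob Ok) as [H|[->|H]]; [tauto|apply crit_mem|].
    apply j_mem in H. apply (ord_trans (proj1 (j_ordinal b) Ob) H crit_mem). }
  assert (Hj : is_bijection (j e) (j b) (power (power a))).
  { rewrite <- (j_fix Ha) at 1. apply (@elementary_iff (is_bijection e b (power (power a)))); [|auto].
    dfn. }
  apply bijection_iff in Hj as [Ij [Nj _]].
  assert (Hy := fun_into_fapp Ij Hk). set (y := fapp (j e) kappa) in *.
  (* Both [y] and [j y] consist of subsets of a, and [j] fixes each of these. *)
  assert (Ey : j y = y).
  { assert (Sj : subset (j y) (power a)).
    { rewrite <- (j_fix Ha). apply (@elementary_iff (subset y (power a))); [dfn|].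
      now apply in_power. }
    apply in_power in Hy. apply ext. intros B. split; intros HB.
    - assert (K := Sj B HB). apply in_power in K. apply j_mem.
      now rewrite (j_subset_fix Ha K).
    - assert (K := Hy B HB). apply in_power in K. apply j_mem in HB.
      now rewrite (j_subset_fix Ha K) in HB. }
  destruct (S y Hy) as [u [Hu Eu]].
  apply (@crit_not_in_range u). apply Nj; auto.
  - now apply j_mem in Hu.
  - assert (K : fapp (j e) (j u) = j y) by (apply (@elementary_iff (fapp e u = y)); [dfn|auto]).
    now rewrite K.
Qed.

Lemma derived_mitchell_order : mitchell_order_eq_succ_pow kappa.
Proof.
  apply mitchell_order_succ_pow.
  - exists U. apply derived_normal.
  - apply crit_strong_limit.
  - apply derived_bounds_measures.
Qed.

Lemma derived_reflection phi A : subset A kappa ->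
  (sat phi (fun _ => A) <-> measure_one kappa U (fun a =>
     exists B, is_inter B A a /\ sat phi (fun _ => B))).
Proof.
  intros HA.
  rewrite (@measure_one_derived _ (fun a => exists B, is_inter B (j A) a /\ sat phi (fun _ => B))).
  - split.
    + intros H. exists A. split; auto. intros x. rewrite <- in_inter.
      now rewrite inter_j.
    + intros [B [HB H]]. replace A with B; auto. rewrite <- (inter_j HA).
      apply ext. intros x. rewrite in_inter. apply HB.
  - apply dfn_ex, dfn_and; [dfn|exact (Rel1_sat j phi)].
Qed.

End DerivedUltrafilter.

(* V is the ambient universe of sets; M may be a set or a proper class of V.
   In the last clause phi(A) is satisfaction under the assignment sending every
   variable to A, so phi ranges over all formulas in one free variable. *)
Theorem theorem13
  (V : structure) (V_ZFC : ZFC V) (V_wf : well_founded (@mem V))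
  (M : V -> Prop) (M_trans : transitive_class M) (M_ZFC : ZFC (restrict M))
  (j : restrict M -> restrict M) (j_elem : elementary j)
  (kappa : restrict M) (j_crit : critical_point j kappa)
  (U : restrict M) (U_def : derived_ultrafilter j kappa U) :
  mitchell_order_eq_succ_pow kappa /\
  every_subset_of_powerset_in_Ult kappa /\
  measure_one kappa U (fun alpha =>
    mitchell_order_eq_succ_pow alpha /\
    every_subset_of_powerset_in_Ult alpha) /\
  (forall (phi : formula) (A : restrict M), subset A kappa ->
     (sat phi (fun _ => A) <->
      measure_one kappa U (fun alpha =>
        exists B, is_inter B A alpha /\ sat phi (fun _ => B)))).
Proof.
  (* External well-foundedness is inherited from [V]; it is what the inductions over arbitrary
     predicates rest on. *)
  assert (W : well_founded (@mem (restrict M)))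
    by exact (wf_inverse_image (restrict M) V (@mem V) (@proj1_sig V M) V_wf).
  assert (P1 := derived_mitchell_order j_elem j_crit U_def).
  assert (P2 := derived_every_subset j_elem j_crit U_def).
  split; auto. split; auto. split.
  - apply (measure_one_derived j_elem j_crit U_def (P' := fun alpha =>
      mitchell_order_eq_succ_pow alpha /\ every_subset_of_powerset_in_Ult alpha)); [dfn|auto].
  - intros phi A. now apply derived_reflection with (j := j).
Qed.
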